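(* Let $n,m,k_1,\dots,k_n$ be natural numbers, $M=k_1+\cdots+k_n-n$, $0\le m\le M-1$. Suppose $n$ algebraic hypersurfaces without multiple factors $f_1(X)=0,\dots,f_n(X)=0$ in $\mathbb{C}^n$, of degrees $k_1,\dots,k_n$ respectively, meet exactly at $N=k_1\cdots k_n$ distinct points, and write $\mathcal{A}=\{Q^{(i)}\}_{i=1}^N$ for the set of these points. Suppose $\tilde{\mathcal{A}}\subset\mathcal{A}$ is a properly posed set of nodes (PPSN) of degree $M-m-1$ along the $0$-dimensional algebraic manifold $S_0=s(f_1,\dots,f_n)$. Then the set of remaining points $\mathcal{B}=\mathcal{A}\setminus\tilde{\mathcal{A}}$ is a PPSN for Lagrange interpolation of degree $m$ along $S_0=s(f_1,\dots,f_n)$.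
   Context: $X=(x_1,\dots,x_n)$. $\mathbb{P}_m^{(n)}$ is the complex vector space of polynomials in $\mathbb{C}[x_1,\dots,x_n]$ of total degree $\le m$. $s(f_1,\dots,f_n)$ is the set of common zeros of $f_1,\dots,f_n$ in $\mathbb{C}^n$. A hypersurface $f(X)=0$ is without multiple factors if $f$ has no repeated non-constant factor. For every integer $m$, $e_m^{(n)}=\binom{m+n}{n}$, with $e_m^{(n)}=0$ for $m<0$. With $\nabla_k u_m=u_m-u_{m-k}$, put $e_m^{(n)}(k_1,\dots,k_n)=\nabla_{k_n}\cdots\nabla_{k_1}e_m^{(n)}$. PPSN: a set $\{P^{(i)}\}$ of exactly $e_d^{(n)}(k_1,\dots,k_n)$ distinct points on $S_0$ is a PPSN for Lagrange interpolation of degree $d$ along $S_0$ if for every set of complex numbers $\{q_i\}_{i=1}^{e_d^{(n)}(k_1,\dots,k_n)}$ there exists $f\in\mathbb{P}_d^{(n)}$ with $f(P^{(i)})=q_i$ for all $i$. *)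

(* Defs.v *)
From mathcomp Require Import all_boot all_order all_algebra.
From mathcomp Require Import finmap mpoly complex reals.

Set Implicit Arguments.
Unset Strict Implicit.
Unset Printing Implicit Defensive.

Import Order.TTheory GRing.Theory Num.Theory.
Local Open Scope ring_scope.

(* Binomial coefficient (m+n choose n), extended by 0 to negative m. *)
Definition e_ (n : nat) (m : int) : int :=
  match m with
  | Posz j => 'C(j + n, n)%:Z
  | Negz _ => 0
  end.

Definition nabla (k : nat) (u : int -> int) : int -> int :=
  fun m => u m - u (m - k%:Z).

(* The operators are applied starting with the one of index 0, so that the
   result reads nabla_{k_{n-1}} ( ... (nabla_{k_0} e)). *)
Definition e_along (n : nat) (k : 'I_n -> nat) : int -> int :=
  foldl (fun u i => nabla (k i) u) (e_ n) (enum 'I_n).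

Section Interpolation.

Variables (C : closedFieldType) (n : nat).

Notation point := {ffun 'I_n -> C}.

(* [msize p] is the total degree plus one, and [msize 0 = 0]. *)
Definition deg_le (d : nat) (p : {mpoly C[n]}) : Prop := (msize p <= d.+1)%N.

Definition has_degree (p : {mpoly C[n]}) (d : nat) : Prop := msize p = d.+1.

Definition no_multiple_factor (p : {mpoly C[n]}) : Prop :=
  forall g h : {mpoly C[n]}, p = g ^+ 2 * h -> (msize g <= 1)%N.

Definition common_zero (f : 'I_n -> {mpoly C[n]}) (x : point) : Prop :=
  forall i : 'I_n, (f i).@[x] = 0.

(* The family [k] is that of the degrees of the hypersurfaces [f]; it only
   determines the required number of nodes. *)
Definition ppsn (k : 'I_n -> nat) (f : 'I_n -> {mpoly C[n]})
    (d : nat) (P : {fset point}) : Prop :=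
  [/\ forall x, x \in P -> common_zero f x,
      (#|` P|)%:Z = e_along k d%:Z
    & forall q : point -> C,
        exists2 g : {mpoly C[n]}, deg_le d g & forall x, x \in P -> g.@[x] = q x].

End Interpolation.

(* Main.v *)
Require Import Defs.
From HB Require Import structures.
From mathcomp Require Import all_boot all_order all_algebra.
From mathcomp Require Import perm finmap mpoly complex reals.
From mathcomp Require Import zify ring lra.

Set Implicit Arguments.
Unset Strict Implicit.
Unset Printing Implicit Defensive.

Import Order.TTheory GRing.Theory Num.Theory.
Local Open Scope ring_scope.

(** The remaining points impose independent conditions on the polynomials of
    degree at most [m] unless there are weights [l], not all zero, with
    [sum_b l_b p(b) = 0] for all these [p]. Two facts about the complete
    intersection [A] exclude such weights.

    The first is the upper bound for its Hilbert function: at most [e_d]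
    polynomials of degree at most [d] are linearly independent on [A]
    ([hilbert_function_bound]). Hence a polynomial of degree at most [d = M - m - 1]
    that vanishes on the given nodes vanishes on [A]. The second is the existence
    of the Bezoutian ([exists_bezoutian]), a polynomial [Delta(a, b)] of total degree
    [M] in both sets of variables, such that on [A] the matrix [Delta(a, b)] is
    diagonal with nonzero entries. The sum of [l_b Delta(a, b)] over [b] kills the
    terms of degree at most [m] in [b] and so has degree at most [d] in [a]. For
    [a] in [A] it equals [l_a Delta(a, a)]; it vanishes on the given nodes, hence on
    [A], and so [l = 0] ([residual_interpolation]).

    Both facts express that [A] has as many points as Bezout's theorem allows, and
    they are derived from the deformation [f_i + t^2 x_i^(k_i)]. For general [t] its
    ideal contains, in degree at most [d], a space of codimension at most [e_d],
    because the multiples of the [x_i^(k_i)] do; the limits of this space for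
    [t -> 0] form a space of the same dimension ([exists_limit_families]). The
    essential point is that the limits vanish on [A]. Otherwise a point of [A]
    would be an isolated component of the zero set in the space of [x] and [t],
    although only [n] equations define it. This is excluded by the local Bezout
    inequality ([local_bezout]), which is proved by counting monomials: the length
    of a local algebra defined by as many equations as there are variables is at
    least the product of the orders of vanishing. For large [d], the number of
    points forces the limits to be all the polynomials that vanish on [A], so
    through a point of [A] there passes only a single transversal branch of the
    deformed zero set. If the Jacobian determinant vanished there, some
    combination of the equations would be singular, and the same inequality would
    be violated by a factor two ([no_small_curve_germ]).

    That points of [A] are isolated is made algebraic by the Nullstellensatz, which
    has a short proof over an uncountable field ([nullstellensatz]). Finally the
    numbers of nodes match because [e_d] counts the monomials of degree at most [d]
    of the box [prod_i {0, ..., k_i - 1}], and the symmetry of the box exchanges the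
    degrees at most [m] and more than [d]. *)

(** * Finite-dimensional linear algebra on families of functions *)

Section LinearAlgebra.

Variables (F : fieldType) (I T : finType).

Lemma sum_enum_val (J : finType) (E : J -> F) :
  \sum_(i < #|J|) E (enum_val i) = \sum_j E j.
Proof. by rewrite [RHS](reindex _ (onW_bij _ (enum_val_bij J))). Qed.

Lemma linear_dependence (v : I -> T -> F) :
  (#|T| < #|I|)%N ->
  exists2 c : I -> F, (exists i, c i != 0) & forall t, \sum_i c i * v i t = 0.
Proof.
move=> ltTI; pose A := \matrix_(i < #|I|, j < #|T|) v (enum_val i) (enum_val j).
have : kermx A != 0.
  rewrite kermx_eq0; apply/negP => /eqP rA.
  by have := rank_leq_col A; rewrite rA leqNgt ltTI.
case/rowV0Pn => w /sub_kermxP wA /rV0Pn [i0 nzw].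
exists (fun i => w 0 (enum_rank i)); first by exists (enum_val i0); rewrite enum_valK.
move=> t; have /matrixP /(_ 0 (enum_rank t)) := wA.
rewrite !mxE => E; rewrite -[RHS]E -[LHS]sum_enum_val; apply: eq_bigr => i _.
by rewrite mxE enum_valK enum_rankK.
Qed.

Lemma span_or_annihilate (v : I -> T -> F) :
  (forall w : T -> F, exists c : I -> F, forall t, \sum_i c i * v i t = w t) \/
  (exists2 l : T -> F, (exists t, l t != 0) & forall i, \sum_t l t * v i t = 0).
Proof.
pose A := \matrix_(i < #|I|, j < #|T|) v (enum_val i) (enum_val j).
have [fA|nfA] := boolP (row_full A); [left=> w|right].
  pose W := \row_(j < #|T|) w (enum_val j).
  have /submxP [c Wc] := submx_full W fA.
  exists (fun i => c 0 (enum_rank i)) => t.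
  have /matrixP /(_ 0 (enum_rank t)) := Wc.
  rewrite !mxE enum_rankK => ->; rewrite -[LHS]sum_enum_val; apply: eq_bigr => i _.
  by rewrite mxE enum_valK enum_rankK.
have : kermx A^T != 0.
  by rewrite kermx_eq0 /row_free mxrank_tr; exact: nfA.
case/rowV0Pn => w /sub_kermxP wA /rV0Pn [j0 nzw].
exists (fun i => w 0 (enum_rank i)); first by exists (enum_val j0); rewrite enum_valK.
move=> i; have /matrixP /(_ 0 (enum_rank i)) := wA.
rewrite !mxE => E; rewrite -[RHS]E -[LHS]sum_enum_val; apply: eq_bigr => j _.
by rewrite !mxE enum_valK enum_rankK.
Qed.

Definition independent (v : I -> T -> F) :=
  forall c : I -> F, (forall t, \sum_i c i * v i t = 0) -> forall i, c i = 0.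

Lemma independent_card (v : I -> T -> F) : independent v -> (#|I| <= #|T|)%N.
Proof.
move=> indv; rewrite leqNgt; apply/negP => /(linear_dependence v) [c [i nz]] /indv.
by move/(_ i)/eqP; rewrite (negbTE nz).
Qed.

End LinearAlgebra.

Lemma spanning_card (F : fieldType) (I T : finType) (v : I -> T -> F) :
  (forall t0, exists c : I -> F, forall t, \sum_i c i * v i t = (t == t0)%:R) ->
  (#|T| <= #|I|)%N.
Proof.
move=> spv; rewrite leqNgt; apply/negP.
move=> /(linear_dependence (fun t i => v i t)) [l [t0 nz] Hl].
have [c Hc] := spv t0; move/negP: nz; apply; apply/eqP.
have <- : \sum_t l t * (t == t0)%:R = l t0.
  by rewrite (bigD1 t0) //= eqxx mulr1 big1 ?addr0 // => t /negbTE ->; rewrite mulr0.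
under eq_bigr => t _ do rewrite -Hc mulr_sumr.
rewrite exchange_big big1 //= => i _.
transitivity (c i * \sum_t l t * v i t); last by rewrite Hl mulr0.
by rewrite mulr_sumr; apply: eq_bigr => t _; rewrite mulrCA.
Qed.

Lemma big_option (V : nmodType) (I : finType) (E : option I -> V) :
  \sum_o E o = E None + \sum_i E (Some i).
Proof.
rewrite (bigD1 None) //=; congr (_ + _).
rewrite (reindex_omap Some id) => [|[i|]] //=.
by apply: eq_bigl => i; rewrite eqxx.
Qed.

(** Adding one more vector to a basis creates a dependency in which the new
    vector must occur. *)
Lemma independent_span (F : fieldType) (I T : finType) (v : I -> T -> F) :
  independent v -> (#|T| <= #|I|)%N ->
  forall w : T -> F, exists c : I -> F, forall t, w t = \sum_i c i * v i t.
Proof.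
move=> indv leTI w.
pose v' (o : option I) := if o is Some i then v i else w.
have [|c [o nzo] Hc] := @linear_dependence _ _ _ v'; first by rewrite card_option ltnS.
have E t : c None * w t + \sum_i c (Some i) * v i t = 0.
  by rewrite -(big_option (fun o => c o * v' o t)) Hc.
have nz : c None != 0.
  apply: contraTneq nzo => z; have zS i : c (Some i) = 0.
    by apply: (indv (fun i => c (Some i))) => t; have := E t; rewrite z mul0r add0r.
  by case: o => [i|]; rewrite ?z ?zS eqxx.
exists (fun i => - (c None)^-1 * c (Some i)) => t.
apply: (mulfI nz); rewrite mulr_sumr.
under eq_bigr => i _ do rewrite -mulrA mulrCA mulrA mulNr mulVf // mulN1r.
by rewrite sumrN; apply/eqP; rewrite -addr_eq0 E.
Qed.

(** * Counting lattice points *)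

Lemma card_simplex (J : finType) (K d : nat) : (d < K)%N ->
  #|[set a : {ffun J -> 'I_K} | (\sum_j a j <= d)%N]| = 'C(#|J| + d, #|J|).
Proof.
move=> ltdK; rewrite -card_partial_ord_partitions.
pose h (t : #|J|.-tuple 'I_d.+1) : {ffun J -> 'I_K} :=
  [ffun j => widen_ord ltdK (tnth t (enum_rank j))].
have sumh t : (\sum_j h t j = \sum_(i <- t) i)%N.
  rewrite big_tuple [RHS](reindex _ (onW_bij _ (enum_rank_bij J))) /=.
  by apply: eq_bigr => j _; rewrite ffunE.
have injh : injective h.
  move=> t u /ffunP eqtu; apply: eq_from_tnth => i.
  have := eqtu (enum_val i); rewrite !ffunE enum_valK => /(congr1 val) /=.
  exact: val_inj.
rewrite -(card_imset _ injh); congr #|pred_of_set _|; apply/setP => a; rewrite inE.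
apply/idP/imsetP => [lead|[t]]; last by rewrite inE => ? ->; rewrite sumh.
have lea j : (a j < d.+1)%N.
  by rewrite ltnS (leq_trans _ lead) // (bigD1 j) //= leq_addr.
exists [tuple Ordinal (lea (enum_val i)) | i < #|J|].
  rewrite inE -sumh (leq_trans _ lead) //; apply: leq_sum => j _.
  by rewrite ffunE tnth_mktuple /= enum_rankK.
apply/ffunP => j; rewrite ffunE tnth_mktuple; apply: val_inj => /=.
by rewrite enum_rankK.
Qed.

Lemma card_monomials (n W : nat) :
  #|{: 'X_{1..n < W.+1}}| = 'C(n + W, n).
Proof.
have := @card_simplex 'I_n W.+1 W (ltnSn W); rewrite card_ord => <-.
have lem (m : 'X_{1..n < W.+1}) (i : 'I_n) : ((m : 'X_{1..n}) i < W.+1)%N.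
  apply: leq_ltn_trans (bmdeg m); rewrite mdegE (bigD1 i) //=; exact: leq_addr.
pose h (m : 'X_{1..n < W.+1}) : {ffun 'I_n -> 'I_W.+1} := [ffun i => Ordinal (lem m i)].
have injh : injective h.
  move=> m1 m2 /ffunP eqh; apply: val_inj; apply/mnmP => i.
  by have := eqh i; rewrite !ffunE => /(congr1 val).
rewrite -(card_imset _ injh); congr #|pred_of_set _|; apply/setP => a; rewrite inE.
apply/imsetP/idP => [[m _ ->]|lea].
  have := bmdeg m; rewrite ltnS mdegE; apply: leq_trans.
  by apply: leq_sum => i _; rewrite ffunE.
have ma : (mdeg [multinom (a i : nat) | i < n] < W.+1)%N.
  by rewrite ltnS mdegE (leq_trans _ lea) //; apply: leq_sum => i _; rewrite mnmE.
exists (BMultinom ma) => //; apply/ffunP => i; rewrite ffunE; apply: val_inj => /=.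
by rewrite mnmE.
Qed.

Definition box (J : finType) (K : nat) (k : J -> nat) : {set {ffun J -> 'I_K}} :=
  [set a : {ffun J -> 'I_K} | [forall j, (a j < k j)%N]].

Lemma card_ord_lt (K k : nat) : (k <= K)%N -> #|[pred x : 'I_K | (x < k)%N]| = k.
Proof.
move=> lekK; rewrite -[RHS]card_ord.
have injw : injective (widen_ord lekK) by move=> x y [] /val_inj.
rewrite -(card_imset _ injw); apply: eq_card => x; rewrite [LHS]inE.
apply/idP/imsetP => [ltx|[y _ ->]]; last exact: ltn_ord y.
by exists (Ordinal ltx) => //; apply: val_inj.
Qed.

Lemma card_box (J : finType) (K : nat) (k : J -> nat) :
  (forall j, (k j <= K)%N) -> #|box K k| = (\prod_j k j)%N.
Proof.
move=> lekK.
have -> : #|box K k| = #|family (fun j => [pred x : 'I_K | (x < k j)%N])|.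
  by apply: eq_card => a; rewrite inE; apply/forallP/familyP => H j; have := H j.
rewrite card_family foldrE big_map -big_enum /=.
by apply: eq_bigr => j _; rewrite card_ord_lt.
Qed.

(** A lattice point [b] is determined by its quotient and its remainder by
    the vector [delta]: the translates by [box delta] of the points
    [delta * a] are disjoint. *)
Lemma card_weighted_simplex (J : finType) (W : nat) (delta : J -> nat) :
  (forall j, 0 < delta j)%N ->
  ((\prod_j delta j) *
     #|[set a : {ffun J -> 'I_W} | (\sum_j delta j * a j < W)%N]| <=
     'C(#|J| + (W + \sum_j delta j), #|J|))%N.
Proof.
move=> delta_gt0; set D := (W + _)%N.
have le_delta j : (delta j <= D.+1)%N.
  by rewrite /D (bigD1 j) //=; lia.
rewrite -(card_box le_delta) -(card_simplex J (ltnSn D)) -cardsX.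
set S := setX _ _.
pose h (p : {ffun J -> 'I_D.+1} * {ffun J -> 'I_W}) : {ffun J -> 'I_D.+1} :=
  [ffun j => inord (delta j * p.2 j + p.1 j)].
have inS p : p \in S -> (\sum_j (delta j * p.2 j + p.1 j) <= D)%N.
  rewrite !inE => /andP [/forallP lt1 lt2].
  rewrite big_split /=; apply: leq_add; first exact: ltnW.
  by apply: leq_sum => j _; apply: ltnW.
have hE p j : p \in S -> h p j = (delta j * p.2 j + p.1 j)%N :> nat.
  move=> /inS leD; rewrite ffunE inordK // ltnS (leq_trans _ leD) //.
  by rewrite [leqRHS](bigD1 j) //= leq_addr.
have injh : {in S &, injective h}.
  move=> p q pS qS eqpq.
  have E j : (p.2 j = q.2 j :> nat) /\ (p.1 j = q.1 j :> nat).
    have : (delta j * p.2 j + p.1 j = delta j * q.2 j + q.1 j)%N by rewrite -!hE // eqpq.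
    move: pS qS; rewrite !inE => /andP [/forallP /(_ j) p1 _] /andP [/forallP /(_ j) q1 _] E.
    split; last first.
      by have := congr1 (modn^~ (delta j)) E; rewrite !(mulnC (delta j)) !modnMDl !modn_small.
    have := congr1 (divn^~ (delta j)) E; rewrite !(mulnC (delta j)).
    by rewrite !divnMDl ?delta_gt0 // !divn_small // !addn0.
  case: p q E {pS qS eqpq} => [p1 p2] [q1 q2] /= E.
  by congr pair; apply/ffunP => j; apply: val_inj; case: (E j).
rewrite -(card_in_imset injh); apply: subset_leq_card; apply/subsetP => a.
case/imsetP => p pS ->; rewrite inE (leq_trans _ (inS _ pS)) //.
by apply: leq_sum => j _; rewrite hE.
Qed.

(** ['C(N + x, N)] grows only polynomially in [x], so the shift by [s] changes it
    by a factor that tends to one as [W] grows. *)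
Lemma binomial_shift_bound (N s l a : nat) :
  (forall W, 'C(N + W, N) * a <= l * 'C(N + (W + s), N))%N -> (a <= l)%N.
Proof.
move=> H; rewrite leqNgt; apply/negP => lt_la.
case: N H => [|N] H; first by have := H 0%N; rewrite !add0n !bin0; lia.
have step W u : ('C(N.+1 + (W + u), N.+1) <= 'C(N.+1 + W, N.+1) + u * 'C(N + (W + u), N))%N.
  elim: u => [|u IHu]; first by rewrite addn0 leq_addr.
  rewrite addnS addnS addSn binS mulSn.
  have : ('C(N + (W + u), N) <= 'C((N + (W + u)).+1, N))%N by rewrite leq_bin2l // leqnSn.
  move: IHu; rewrite addSn addnS; nia.
(* For this [W] the relative increment [s (N + 1) / (W + s)] is below [1 / a]. *)
pose W := (a * s * N.+1)%N.
have := H W; have := step W s.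
have pasc : (N.+1 * 'C(N.+1 + (W + s), N.+1) = (N.+1 + (W + s)) * 'C(N + (W + s), N))%N.
  by rewrite addSn -mul_bin_diag.
have : (0 < 'C(N + (W + s), N))%N by rewrite bin_gt0 leq_addr.
move: pasc; set P := 'C(N.+1 + (W + s), N.+1); set Q := 'C(N.+1 + W, N.+1).
set B := 'C(N + (W + s), N) => pasc B0 h1 h2.
have h3 : (P <= a * s * B)%N.
  have : (a * P <= a * Q + a * s * B)%N by rewrite -mulnA -mulnDr leq_mul2l h1 orbT.
  have : (l * P + P <= a * P)%N by rewrite -mulSnr leq_mul2r lt_la orbT.
  move: h2; rewrite (mulnC Q a); lia.
have : (N.+1 * P <= N.+1 * (a * s * B))%N by rewrite leq_mul2l h3 orbT.
rewrite pasc /W; nia.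
Qed.

Section HilbertFunction.

Variables (n : nat) (k : 'I_n -> nat).

(** The Hilbert function of the monomial complete intersection
    [x_1^(k_1), ..., x_n^(k_n)]: the number of monomials of degree at most [d]
    that none of these powers divides. *)
Definition small_box (K d : nat) : {set {ffun 'I_n -> 'I_K}} :=
  [set a in box K k | (\sum_j a j <= d)%N].

Let count_on (K : nat) (s : seq 'I_n) (x : int) : int :=
  if x is Posz d then
    #|[set a : {ffun 'I_n -> 'I_K} |
        (\sum_j a j <= d)%N && all (fun j => (a j < k j)%N) s]|%:Z
  else 0.

(** The points with [k i <= a i] are the translates by [k i] of all the points of
    smaller weight, so counting those with [a i < k i] amounts to [nabla (k i)]. *)
Lemma e_along_card (K d : nat) : (d < K)%N -> e_along k d%:Z = #|small_box K d|%:Z.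
Proof.
have main s : uniq s -> forall x : int, x < K%:Z ->
    foldl (fun u i => nabla (k i) u) (e_ n) s x = count_on K s x.
  elim/last_ind: s => [_|s i IHs].
    case=> // e ltxK; have := @card_simplex 'I_n K e ltxK.
    rewrite card_ord addnC /= => <-; congr (Posz #|pred_of_set _|).
    by apply/setP => a; rewrite !inE andbT.
  rewrite rcons_uniq foldl_rcons => /andP [sNi us] x ltxK.
  rewrite /nabla !IHs //; last by lia.
  case: x ltxK => [e|e] ltxK; last first.
    by case Ex: (Negz e - (k i)%:Z) => [y|y] //=; lia.
  set A := [set a : {ffun 'I_n -> 'I_K} |
    (\sum_j a j <= e)%N && all (fun j => (a j < k j)%N) s].
  set B := [set a : {ffun 'I_n -> 'I_K} | (a i < k i)%N].
  have -> : count_on K (rcons s i) e = #|A :&: B|%:Z.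
    congr (Posz #|pred_of_set _|); apply/setP => a; rewrite !inE all_rcons.
    by rewrite -andbA [X in _ && X]andbC.
  have -> : count_on K s e = #|A|%:Z by [].
  rewrite -(cardsID B A) PoszD.
  suff -> : count_on K s (e%:Z - (k i)%:Z) = #|A :\: B|%:Z by rewrite addrK.
  have leA a : a \in A -> (a i <= e)%N.
    by rewrite inE => /andP [le _]; rewrite (leq_trans _ le) // (bigD1 i) //= leq_addr.
  have [leke|ltek] := leqP (k i) e; last first.
    case Ex: (e%:Z - (k i)%:Z) => [y|y] /=; first by lia.
    symmetry; congr Posz; apply: eq_card0 => a; rewrite inE; apply/negP => /andP [].
    by rewrite inE -leqNgt => leka /leA /(leq_trans leka); rewrite leqNgt ltek.
  rewrite subzn //=; congr Posz.
  pose h (a : {ffun 'I_n -> 'I_K}) : {ffun 'I_n -> 'I_K} :=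
    [ffun j => if insub (a j + (j == i) * k i)%N is Some y then y else a j].
  set A' := [set a | _].
  have sumi (a : {ffun 'I_n -> 'I_K}) :
      (\sum_j (a j + (j == i) * k i) = \sum_j a j + k i)%N.
    rewrite big_split /=; congr addn; rewrite (bigD1 i) //= eqxx mul1n big1 ?addn0 //.
    by move=> j /negbTE ->.
  have hE a j : a \in A' -> h a j = (a j + (j == i) * k i)%N :> nat.
    rewrite inE => /andP [lea _]; rewrite ffunE.
    case: insubP => [y _ //|/negP []].
    apply: (@leq_trans e.+1) => //; rewrite ltnS.
    apply: (@leq_trans (\sum_j (a j + (j == i) * k i))).
      by rewrite (bigD1 j) //= leq_addr.
    by rewrite sumi -[leqRHS](subnK leke) leq_add2r.
  have injh : {in A' &, injective h}.
    move=> a b aA bA eqab; apply/ffunP => j; apply: val_inj => /=.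
    by apply/eqP; rewrite -(eqn_add2r ((j == i) * k i)) -!hE // eqab.
  rewrite -(card_in_imset injh); congr #|pred_of_set _|; apply/setP => b.
  apply/imsetP/idP => [[a aA ->]|].
    have hEa j := hE a j aA; move: aA; rewrite inE => /andP [lea alla].
    rewrite !inE hEa eqxx mul1n -leqNgt leq_addl /=.
    under eq_bigr => j _ do rewrite hEa.
    rewrite sumi; apply/andP; split; first by rewrite -[leqRHS](subnK leke) leq_add2r.
    apply/allP => j js; rewrite hEa; case: eqP => [ji|_].
      by rewrite ji (negbTE sNi) in js.
    by rewrite addn0 (allP alla).
  rewrite !inE -leqNgt => /and3P [leki leb allb].
  pose a : {ffun 'I_n -> 'I_K} :=
    [ffun j => Ordinal (leq_ltn_trans (leq_subr ((j == i) * k i) (b j)) (ltn_ord (b j)))].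
  have aE j : (a j + (j == i) * k i = b j)%N.
    by rewrite ffunE /=; case: eqP => [->|_]; rewrite ?mul1n ?mul0n ?subnK // subn0 addn0.
  have aA : a \in A'.
    rewrite inE; apply/andP; split.
      have := sumi a; under eq_bigr => j _ do rewrite aE.
      by move=> E; rewrite -(leq_add2r (k i)) -E subnK.
    apply/allP => j js; rewrite (leq_ltn_trans _ (allP allb _ js)) //.
    by rewrite -(aE j) leq_addr.
  by exists a => //; apply/ffunP => j; apply: val_inj; rewrite /= hE // aE.
move=> ltdK; rewrite /e_along main ?enum_uniq //; congr (Posz #|pred_of_set _|).
apply/setP => a; rewrite !inE andbC; congr (_ && _).
apply/allP/forallP => H j; first by apply: H; rewrite mem_enum.
by move=> _; apply: H.
Qed.

(** Replacing [a] by [k - 1 - a] turns the points of weight at most [m] of the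
    box into those of weight more than [d]. *)
Lemma card_small_box_dual (K m d : nat) :
  (forall j, 0 < k j <= K)%N -> (m + d).+1 = (\sum_j (k j).-1)%N ->
  (#|small_box K m| + #|small_box K d| = \prod_j k j)%N.
Proof.
move=> kK Emd; rewrite -(@card_box _ K k); last by move=> j; case/andP: (kK j).
rewrite -(cardsID (small_box K d) (box K k)) addnC.
have -> : box K k :&: small_box K d = small_box K d.
  by apply/setIidPr/subsetP => a; rewrite inE => /andP [].
congr addn.
have ltr (a : {ffun 'I_n -> 'I_K}) j : ((k j).-1 - a j < K)%N.
  by case/andP: (kK j); lia.
pose r (a : {ffun 'I_n -> 'I_K}) : {ffun 'I_n -> 'I_K} := [ffun j => Ordinal (ltr a j)].
have rbox a : r a \in box K k.
  by rewrite inE; apply/forallP => j; rewrite ffunE /=; case/andP: (kK j); lia.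
have rK a : a \in box K k -> r (r a) = a.
  rewrite inE => /forallP lta; apply/ffunP => j; apply: val_inj.
  have := lta j; rewrite !ffunE /= !ffunE /= => ltaj; rewrite subKn //.
  by rewrite -ltnS (leq_trans ltaj) // leqSpred.
have rsum a : a \in box K k -> (\sum_j r a j + \sum_j a j = (m + d).+1)%N.
  rewrite inE => /forallP lta; rewrite Emd -big_split /=.
  apply: eq_bigr => j _; have ltaj := lta j; rewrite ffunE /= subnK //.
  by rewrite -ltnS (leq_trans ltaj) // leqSpred.
have injr : {in small_box K m &, injective r}.
  move=> a b; rewrite !inE => /andP [aB _] /andP [bB _] /(congr1 r).
  by rewrite !rK ?inE.
rewrite -(card_in_imset injr); congr #|pred_of_set _|; apply/setP => b.
apply/imsetP/idP => [[a aS ->]|].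
  move: aS; rewrite inE => /andP [aB lea]; rewrite !inE.
  have := rbox a; rewrite inE => ->; rewrite /= andbT -ltnNge.
  by move: lea (rsum a aB); move: (\sum_j a j)%N (\sum_j r a j)%N => x y; lia.
rewrite inE => /andP [bNS bB]; exists (r b); last by rewrite rK.
rewrite inE rbox /=; move: bNS; rewrite inE bB /= -ltnNge.
by move: (rsum b bB); move: (\sum_j b j)%N (\sum_j r b j)%N => x y; lia.
Qed.

End HilbertFunction.

(** * Order of vanishing at the origin *)

Section Order.

Variables (F : fieldType) (n : nat).
Notation S := {mpoly F[n]}.
Implicit Types (p q : S).

(** Membership in the [W]-th power of the maximal ideal of the origin. *)
Definition ord_ge (W : nat) p := forall m, (mdeg m < W)%N -> p@_m = 0.

Lemma ord_ge0 W : ord_ge W 0.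
Proof. by move=> m _; rewrite mcoeff0. Qed.

Lemma ord_geD W p q : ord_ge W p -> ord_ge W q -> ord_ge W (p + q).
Proof. by move=> Hp Hq m lt; rewrite mcoeffD Hp // Hq // addr0. Qed.

Lemma ord_geN W p : ord_ge W p -> ord_ge W (- p).
Proof. by move=> Hp m lt; rewrite mcoeffN Hp // oppr0. Qed.

Lemma ord_ge_sum W (J : finType) (p : J -> S) :
  (forall j, ord_ge W (p j)) -> ord_ge W (\sum_j p j).
Proof.
move=> H; apply: (big_ind (ord_ge W)) => [|p1 p2|j _]; last exact: H.
  exact: ord_ge0.
exact: ord_geD.
Qed.

Lemma ord_ge_leq W V p : (V <= W)%N -> ord_ge W p -> ord_ge V p.
Proof. by move=> le H m lt; apply: H; apply: leq_trans le. Qed.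

Lemma ord_geM W V p q : ord_ge W p -> ord_ge V q -> ord_ge (W + V) (p * q).
Proof.
move=> Hp Hq m lt; rewrite mcoeffM big1 // => -[k1 k2] /= /eqP Em.
have [lt1|le1] := ltnP (mdeg k1) W; first by rewrite Hp ?mul0r.
rewrite (Hq k2) ?mulr0 //; have := congr1 mdeg Em; rewrite mdegD; lia.
Qed.

Lemma ord_ge_all p : ord_ge 0 p. Proof. by []. Qed.

Lemma ord_geMl W p q : ord_ge W q -> ord_ge W (p * q).
Proof. by move=> H; rewrite -[W]add0n; apply: ord_geM. Qed.

Lemma ord_ge1 p : p@_0%MM = 0 -> ord_ge 1 p.
Proof. by move=> p0 m; rewrite ltnS leqn0 mdeg_eq0 => /eqP ->. Qed.

Lemma ord_geX W p i : ord_ge W p -> ord_ge (i * W) (p ^+ i).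
Proof.
move=> Hp; elim: i => [|i IHi]; first exact: ord_ge_all.
by rewrite exprS mulSn; apply: ord_geM.
Qed.

Lemma ord_ge_prod (J : finType) (delta : J -> nat) (p : J -> S) :
  (forall j, ord_ge (delta j) (p j)) ->
  ord_ge (\sum_j delta j) (\prod_j p j).
Proof.
move=> H; apply: (big_ind2 (fun W p => ord_ge W p)) => // p1 W1 p2 W2 H1 H2.
exact: ord_geM.
Qed.

(** A polynomial that does not vanish at the origin is a unit of the local
    ring; a partial sum of the geometric series is an approximate inverse. *)
Lemma ord_ge_inverse W p : p@_0%MM != 0 -> exists v, ord_ge W (p * v - 1).
Proof.
move=> nz; pose c := p@_0%MM; pose q := 1 - c^-1 *: p.
have q1 : ord_ge 1 q.
  by apply: ord_ge1; rewrite mcoeffB mcoeff1 eqxx mcoeffZ mulVf // subrr.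
exists (c^-1 *: \sum_(i < W) q ^+ i).
have -> : p * (c^-1 *: \sum_(i < W) q ^+ i) - 1 = - q ^+ W.
  have E : c^-1 *: p = 1 - q by rewrite /q opprB addrC subrK.
  by rewrite -scalerAr scalerAl E -[1 - q]opprB mulNr -subrX1 opprB addrAC subrr add0r.
by apply: ord_geN; rewrite -[X in ord_ge X]muln1; apply: ord_geX.
Qed.

Lemma split_constant p :
  exists q : 'I_n -> S, p = (p@_0%MM)%:MP + \sum_j 'X_j * q j.
Proof.
have mono m : exists q : 'I_n -> S,
    'X_[m] = (('X_[m] : S)@_0%MM)%:MP + \sum_j 'X_j * q j.
  have [->|nz] := eqVneq m 0%MM.
    exists (fun=> 0); rewrite big1 => [|j _]; last by rewrite mulr0.
    by rewrite mcoeffX eqxx mpolyX0 addr0.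
  have [j nzj] : exists j, m j != 0%N.
    apply/existsP; apply: contraNT nz; rewrite negb_exists => /forallP z.
    by apply/eqP/mnmP => j; rewrite mnm0E; apply/eqP; have := z j; rewrite negbK.
  exists (fun i => if i == j then 'X_[m - U_(j)] else 0).
  rewrite mcoeffX (negbTE nz) mpolyC0 add0r (bigD1 j) //= eqxx big1 ?addr0.
    by rewrite -mpolyXD addmC submK // lep1mP.
  by move=> i /negbTE ->; rewrite mulr0.
elim/mpolyind: p => [|c m p _ _ [q Eq]].
  by exists (fun=> 0); rewrite mcoeff0 mpolyC0 add0r big1 // => j _; rewrite mulr0.
have [q' Eq'] := mono m; exists (fun j => c *: q' j + q j).
rewrite {1}Eq {1}Eq' mcoeffD mcoeffZ mpolyCD mpolyCM scalerDr -!mul_mpolyC.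
rewrite -!addrA; congr (_ + _); rewrite addrCA; congr (_ + _).
rewrite mulr_sumr -big_split; apply: eq_bigr => j _ /=.
by rewrite mulrDr -scalerAr mul_mpolyC.
Qed.

End Order.

(** * The local Bezout inequality *)

Section LocalIdeal.

Variables (F : fieldType) (n : nat) (J : finType).
Notation S := {mpoly F[n]}.
Implicit Types (p q : S) (g : J -> S).

(** The ideal generated by the [g j], in the local ring of the origin truncated
    at order [W]. *)
Definition local_ideal W g p :=
  exists b : J -> S, ord_ge W (p - \sum_j b j * g j).

Lemma local_ideal_ord W g p : ord_ge W p -> local_ideal W g p.
Proof.
move=> H; exists (fun=> 0); rewrite big1 ?subr0 // => j _; exact: mul0r.
Qed.

Lemma local_ideal_gen W g b : local_ideal W g (\sum_j b j * g j).
Proof. by exists b; rewrite subrr; apply: ord_ge0. Qed.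

Lemma local_ideal_gen1 W g j : local_ideal W g (g j).
Proof.
suff -> : g j = \sum_i (i == j)%:R * g i by apply: local_ideal_gen.
rewrite (bigD1 j) //= eqxx mul1r big1 ?addr0 // => i /negbTE ->; exact: mul0r.
Qed.

Lemma local_idealD W g p q :
  local_ideal W g p -> local_ideal W g q -> local_ideal W g (p + q).
Proof.
move=> [b Hb] [c Hc]; exists (fun j => b j + c j).
have -> : p + q - \sum_j (b j + c j) * g j =
    (p - \sum_j b j * g j) + (q - \sum_j c j * g j).
  by under eq_bigr => j _ do rewrite mulrDl; rewrite big_split /= opprD addrACA.
exact: ord_geD.
Qed.

Lemma local_idealMl W g p q : local_ideal W g q -> local_ideal W g (p * q).
Proof.
move=> [b Hb]; exists (fun j => p * b j).
have -> : p * q - \sum_j (p * b j) * g j = p * (q - \sum_j b j * g j).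
  by rewrite mulrBr mulr_sumr; under eq_bigr => j _ do rewrite -mulrA.
exact: ord_geMl.
Qed.

Lemma local_idealMr W g p q : local_ideal W g p -> local_ideal W g (p * q).
Proof. by rewrite mulrC; apply: local_idealMl. Qed.

Lemma local_idealN W g p : local_ideal W g p -> local_ideal W g (- p).
Proof. by move=> H; rewrite -mulN1r; apply: local_idealMl. Qed.

Lemma local_idealB W g p q :
  local_ideal W g p -> local_ideal W g q -> local_ideal W g (p - q).
Proof. by move=> Hp Hq; apply/local_idealD/local_idealN. Qed.

Definition local_span (L : finType) W g (E : L -> S) p :=
  exists c : L -> F, local_ideal W g (p - \sum_l c l *: E l).

Variables (L : finType) (W : nat) (g : J -> S) (E : L -> S).
Notation span := (local_span W g E).

Lemma local_span_ideal p : local_ideal W g p -> span p.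
Proof.
by move=> H; exists (fun=> 0); rewrite big1 ?subr0 // => l _; rewrite scale0r.
Qed.

Lemma local_span_gen l : span (E l).
Proof.
exists (fun i => (i == l)%:R); rewrite (bigD1 l) //= eqxx scale1r big1 ?addr0 ?subrr.
  exact/local_ideal_ord/ord_ge0.
by move=> i /negbTE ->; rewrite scale0r.
Qed.

Lemma local_spanD p q : span p -> span q -> span (p + q).
Proof.
move=> [b Hb] [c Hc]; exists (fun j => b j + c j).
have -> : p + q - \sum_l (b l + c l) *: E l =
    (p - \sum_l b l *: E l) + (q - \sum_l c l *: E l).
  by under eq_bigr => l _ do rewrite scalerDl; rewrite big_split /= opprD addrACA.
exact: local_idealD.
Qed.

Lemma local_spanZ a p : span p -> span (a *: p).
Proof.
move=> [c Hc]; exists (fun l => a * c l).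
have -> : a *: p - \sum_l (a * c l) *: E l = a%:MP * (p - \sum_l c l *: E l).
  by rewrite mul_mpolyC scalerBr scaler_sumr; under eq_bigr => l _ do rewrite -scalerA.
exact: local_idealMl.
Qed.

Lemma local_span_sum (I : Type) (r : seq I) (P : pred I) (p : I -> S) :
  (forall i, P i -> span (p i)) -> span (\sum_(i <- r | P i) p i).
Proof.
move=> H; apply: big_ind => // [|p1 p2]; last exact: local_spanD.
exact/local_span_ideal/local_ideal_ord/ord_ge0.
Qed.

End LocalIdeal.

(** If the local algebra of as many elements [g j] as there are variables has
    dimension at most [#|L|], and if [g j] vanishes to the order [delta j] at the
    origin, then the product of the orders is at most [#|L|]. Indeed the elements
    [E l * g ^ a] span, and comparing the number of these with the number of
    monomials, for all polynomials up to the order [W], gives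
    ['C(n + W, n) <= #|L| * #{a | sum_j delta_j a_j <= W}]; the right-hand count is
    asymptotically a fraction [1 / prod_j delta_j] of the left-hand side. *)
Lemma local_bezout (F : fieldType) (n : nat) (J L : finType)
    (delta : J -> nat) (g : J -> {mpoly F[n]}) (E : L -> {mpoly F[n]}) :
  #|J| = n -> (forall j, (0 < delta j)%N) -> (forall j, ord_ge (delta j) (g j)) ->
  (forall W p, local_span W g E p) -> (\prod_j delta j <= #|L|)%N.
Proof.
move=> cardJ delta_gt0 ord_g spanE.
apply: (@binomial_shift_bound n (\sum_j delta j).+1) => W.
pose A := [set a : {ffun J -> 'I_W.+1} | (\sum_j delta j * a j < W.+1)%N].
have leA : ('C(n + W, n) <= #|L| * #|A|)%N.
  rewrite -card_monomials.
  pose I := (L * {a : {ffun J -> 'I_W.+1} | a \in A})%type.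
  have -> : (#|L| * #|A| = #|{: I}|)%N by rewrite card_prod card_sig.
  pose gX (a : J -> nat) := \prod_j g j ^+ a j.
  pose Eg (i : I) := E i.1 * gX (fun j => val i.2 j).
  have gX_ord a : ord_ge (\sum_j delta j * a j) (gX a).
    by apply: ord_ge_prod => j; rewrite mulnC; apply: ord_geX.
  (* With no generator left, only the truncation at order [W + 1] remains. *)
  pose g0 (i : void) : {mpoly F[n]} := 0.
  have big_void (b : void -> {mpoly F[n]}) : \sum_i b i = 0 by rewrite big1 // => -[].
  have main u : forall (a : J -> nat) p, (W.+1 <= \sum_j delta j * a j + u)%N ->
      local_span W.+1 g0 Eg (p * gX a).
    elim: u => [|u IHu] a p le.
      apply/local_span_ideal/local_ideal_ord/ord_geMl.
      by apply: ord_ge_leq (gX_ord a); rewrite addn0 in le.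
    have [leW|ltW] := leqP W.+1 (\sum_j delta j * a j).
      by apply/local_span_ideal/local_ideal_ord/ord_geMl/(ord_ge_leq leW).
    have lta j : (a j < W.+1)%N.
      apply: leq_ltn_trans ltW; rewrite (bigD1 j) //=.
      by apply: leq_trans (leq_addr _ _); rewrite leq_pmull.
    have aA : [ffun j => Ordinal (lta j)] \in A.
      rewrite inE; apply: leq_ltn_trans ltW.
      by apply: leq_sum => j _; rewrite ffunE.
    have [c [b Hb]] := spanE W.+1 p.
    set r := _ - _ in Hb.
    have -> : p * gX a = \sum_l c l *: (E l * gX a) +
        (\sum_j b j * gX (fun i => a i + (i == j))%N + r * gX a).
      have gXS j : gX (fun i => a i + (i == j))%N = g j * gX a.
        rewrite /gX (bigD1 j) //= [in RHS](bigD1 j) //= eqxx addn1 exprS mulrA.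
        by congr (_ * _); apply: eq_bigr => i /negbTE ->; rewrite addn0.
      have -> : \sum_l c l *: (E l * gX a) = (\sum_l c l *: E l) * gX a.
        by rewrite mulr_suml; apply: eq_bigr => l _; rewrite scalerAl.
      have -> : \sum_j b j * gX (fun i => a i + (i == j))%N = (\sum_j b j * g j) * gX a.
        by rewrite mulr_suml; apply: eq_bigr => j _; rewrite gXS mulrA.
      by rewrite -!mulrDl /r [_ + (_ - _)]addrC subrK addrC subrK.
    apply: local_spanD; last apply: local_spanD.
    - apply: local_span_sum => l _; apply: local_spanZ.
      suff -> : E l * gX a = Eg (l, exist (fun a => is_true (a \in A)) _ aA) by apply: local_span_gen.
      by congr (_ * _); apply: eq_bigr => j _; rewrite /= ffunE.
    - apply: local_span_sum => j _; apply: IHu.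
      have -> : (\sum_i delta i * (a i + (i == j)) = \sum_i delta i * a i + delta j)%N.
        under eq_bigr => i _ do rewrite mulnDr.
        rewrite big_split /=; congr addn; rewrite (bigD1 j) //= eqxx muln1 big1 ?addn0 //.
        by move=> i /negbTE ->; rewrite muln0.
      by have := delta_gt0 j; move: le; lia.
    - by apply/local_span_ideal/local_ideal_ord; rewrite mulrC; apply: ord_geMl.
  have spanA p : local_span W.+1 g0 Eg p.
    have := main W.+1 (fun=> 0%N) p; rewrite leq_addl /gX.
    by rewrite big1 // mulr1; apply.
  apply: (@spanning_card F _ _ (fun i (m : 'X_{1..n < W.+1}) => (Eg i)@_m)) => m0.
  have [c [b]] := spanA 'X_[m0]; rewrite big_void subr0 => Hc.
  exists c => m; have /eqP := Hc m (bmdeg m).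
  rewrite mcoeffB subr_eq0 mcoeffX -bmeqP => /eqP Em.
  by rewrite eq_sym Em raddf_sum; apply: eq_bigr => i _ /=; rewrite mcoeffZ.
have := @card_weighted_simplex J W.+1 delta delta_gt0; rewrite -/A cardJ.
rewrite addSnnS => le2; apply: leq_trans (leq_mul (leqnn _) le2).
by rewrite mulnCA mulnC leq_mul2l leA orbT.
Qed.

Section CurveGerm.

Variables (F : fieldType) (n : nat).
Notation S := {mpoly F[n.+1]}.
Notation t := ('X_ord_max : S).

(** Suppose that [n] equations [g i] in [n] variables and the parameter [t]
    define a germ of a curve which meets [t = 0] in the origin only ([Hfin]), and
    that, after inverting [t], this germ is empty, or (if [e]) has at most one
    branch, transversal to [t = 0] ([Hgen]). The germ then cannot be empty, and if
    one equation is singular at the origin ([Hg]), it cannot have a single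
    transversal branch either. For adding the equation [t ^ r = 0] yields a local
    algebra of dimension at most [e * r] plus a constant, whereas the local Bezout
    inequality asks for at least [(1 + e) * r]. *)
Lemma no_small_curve_germ (g : 'I_n -> S) (e : bool) (i0 : 'I_n) (s c : nat)
    (Hg : forall i, ord_ge (1 + (e && (i == i0))) (g i))
    (Hfin : forall W (j : 'I_n),
       exists q, local_ideal W g ('X_(lift ord_max j) ^+ c + t * q))
    (Hgen : forall W (p : S), (e -> p@_0%MM = 0) ->
       exists q, local_ideal W g (t ^+ s * (p + t * q))) :
  False.
Proof.
pose B := (s + c * s)%N; pose r := (B ^ n.+1).+1.
pose L := ({ffun 'I_n.+1 -> 'I_B} + 'I_(e * r))%type.
pose g' (o : option 'I_n) := if o is Some i then g i else t ^+ r.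
pose delta (o : option 'I_n) := if o is Some i then (1 + (e && (i == i0)))%N else r.
pose E (l : L) : S :=
  match l with inl a => 'X_[ [multinom (a j : nat) | j < n.+1] ] | inr i => t ^+ i end.
have cardL : #|{: L}| = (B ^ n.+1 + e * r)%N.
  by rewrite card_sum card_ffun !card_ord.
have prod_delta : (\prod_o delta o = (1 + e) * r)%N.
  rewrite (bigD1 None) //= mulnC; congr muln.
  rewrite (bigD1 (Some i0)) //= eqxx andbT big1 ?muln1 //.
  case=> [i|] //= ne; have /negbTE -> : i != i0 by apply: contraNneq ne => ->.
  by rewrite andbF.
have ord_g' o : ord_ge (delta o) (g' o).
  case: o => [i|] /=; first exact: Hg.
  rewrite -[r in ord_ge r]muln1; apply: ord_geX; apply: ord_ge1.
  by rewrite mcoeffX mnm1_eq0.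
have sub_g W p : local_ideal W g p -> local_ideal W g' p.
  move=> [b Hb]; exists (fun o => if o is Some i then b i else 0).
  by rewrite big_option mul0r add0r.
have := @local_bezout F n.+1 _ _ delta g' E; rewrite card_option card_ord => H.
suff : (\prod_o delta o <= #|{: L}|)%N.
  by rewrite cardL prod_delta mulnDl mul1n leq_add2r ltnn.
apply: H => // [[i|] //|W p].
have tpow i (q : S) : (r <= i)%N -> local_ideal W g' (t ^+ i * q).
  move=> le; rewrite -(subnK le) exprD -mulrA mulrCA.
  exact/local_idealMr/(local_ideal_gen1 W g' None).
(* Multiples of [t ^ s] reduce to powers of [t], by descending induction on
   their [t]-adic order. *)
have high u : forall i q, (s <= i)%N -> (r <= i + u)%N -> local_span W g' E (t ^+ i * q).
  elim: u => [|u IHu] i q le_si le_ri.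
    by apply/local_span_ideal/tpow; rewrite addn0 in le_ri.
  pose a := if e then q@_0%MM else 0.
  have [|q' Hq'] := Hgen W (q - a%:MP).
    by rewrite /a => ->; rewrite mcoeffB mcoeffC eqxx mulr1 subrr.
  have -> : t ^+ i * q = a *: t ^+ i +
      (t ^+ (i - s) * (t ^+ s * (q - a%:MP + t * q')) + t ^+ i.+1 * (- q')).
    rewrite [t ^+ (i - s) * _]mulrA -exprD subnK // -mul_mpolyC exprSr.
    ring.
  apply: local_spanD; last apply: local_spanD.
  - have [|he] : a = 0 \/ e by rewrite /a; case: (e); [right|left].
      by move->; rewrite scale0r; apply/local_span_ideal/local_ideal_ord/ord_ge0.
    apply: local_spanZ; have [le|lt] := leqP r i.
      by apply: local_span_ideal; rewrite -[t ^+ i]mulr1; apply: tpow.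
    have lt' : (i < e * r)%N by rewrite he mul1n.
    exact: (@local_span_gen _ _ _ _ W g' E (inr (Ordinal lt'))).
  - by apply/local_span_ideal/local_idealMl/sub_g.
  - by apply: IHu; [apply: leqW|rewrite addSnnS].
rewrite [p]mpolyE; apply: local_span_sum => m _; apply: local_spanZ.
have [/forallP ltB|] := boolP [forall j, (m j < B)%N].
  suff -> : 'X_[m] = E (inl [ffun j => Ordinal (ltB j)]) by apply: local_span_gen.
  by congr mpolyX; apply/mnmP => j; rewrite mnmE ffunE.
rewrite negb_forall => /existsP [j]; rewrite -leqNgt => leB.
have -> : 'X_[m] = 'X_j ^+ B * 'X_[m - U_(j) *+ B] :> S.
  rewrite mpolyXn -mpolyXD addmC submK //; apply/mnm_lepP => i.
  by rewrite mulmnE mnm1E; case: eqP => [<-|_]; rewrite ?mul1n ?mul0n.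
move: 'X_[m - _] => Q; case: (unliftP ord_max j) => [j' ->|->].
  have [q Hq] := Hfin W j'; set y := 'X_(lift _ _) in Hq *.
  have powers : local_ideal W g ((y ^+ c) ^+ s - (- (t * q)) ^+ s).
    by rewrite subrXX opprK; apply: local_idealMr.
  have -> : y ^+ B * Q =
      y ^+ s * Q * ((y ^+ c) ^+ s - (- (t * q)) ^+ s) +
      t ^+ s * ((- q) ^+ s * (y ^+ s * Q)).
    by rewrite /B exprD -mulrN exprMn -exprM; ring.
  apply: local_spanD; first by apply/local_span_ideal/local_idealMl/sub_g.
  by apply: (high r); rewrite ?leq_addl.
rewrite /B exprD -mulrA; apply: (high r); by rewrite ?leq_addl.
Qed.

End CurveGerm.

(** * Limits of families of polynomials *)

Section Limits.

Variables (F : fieldType) (n : nat).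
Notation A := {mpoly F[n]}.
Notation T := {poly A}.

Lemma poly_divX (R : nzRingType) (p : {poly R}) : p`_0 = 0 -> exists q, p = 'X * q.
Proof.
elim/poly_ind: p => [|p c _]; first by exists 0; rewrite mulr0.
rewrite coefD coefMX coefC eqxx add0r => ->.
by exists p; rewrite addr0 commr_polyX.
Qed.

(** Elementary operations turn [D] families that are independent for general
    [t] into [D] families whose values at [t = 0] are independent: a relation
    between these values yields a combination divisible by [t], and replacing one
    of the families by the quotient decreases the order in [t] of the
    determinant. *)
Lemma saturated_limits (D : nat) (X : T -> Prop)
    (Xlin : forall (c : 'I_D -> F) (v : 'I_D -> T), (forall i, X (v i)) ->
      X (\sum_i (c i)%:MP *: v i))
    (Xdiv : forall v, X ('X * v) -> X v)
    (kappa : 'I_D -> 'X_{1..n}) (G : 'I_D -> T) :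
  (forall i, X (G i)) ->
  \det (\matrix_(i, j) map_poly (mcoeff (kappa j)) (G i)) != 0 ->
  exists2 G' : 'I_D -> T, forall i, X (G' i) &
    forall c : 'I_D -> F, \sum_i (c i)%:MP * (G' i)`_0 = 0 -> forall i, c i = 0.
Proof.
pose M (H : 'I_D -> T) := \matrix_(i, j) map_poly (mcoeff (kappa j)) (H i).
rewrite -/(M G); have [u] := ubnP (size (\det (M G))).
elim: u G => // u IHu G ltu XG nzM.
have [ind|] := boolp.EM (forall c : 'I_D -> F,
    \sum_i (c i)%:MP * (G i)`_0 = 0 -> forall i, c i = 0); first by exists G.
move/boolp.existsNP => [c] /boolp.not_implyP [c0] /boolp.existsNP [i1 /eqP nzc].
have [v Ev] : exists v, \sum_i (c i)%:MP *: G i = 'X * v.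
  apply: poly_divX; rewrite -[RHS]c0 coef_sum.
  by apply: eq_bigr => i _; rewrite coefZ.
have Xv : X v by apply: Xdiv; rewrite -Ev; apply: Xlin.
pose G' i := if i == i1 then v else G i.
pose U0 : 'M[F]_D := \matrix_(i, j) if i == i1 then c j else (i == j)%:R.
pose Z : 'rV[{poly F}]_D := \row_i (if i == i1 then 'X else 1).
have UM : map_mx polyC U0 *m M G = diag_mx Z *m M G'.
  apply/matrixP => i j; rewrite mul_diag_mx !mxE.
  under eq_bigr => l _ do rewrite !mxE.
  rewrite /G'; case: eqP => [_|ne].
    apply/polyP => e; rewrite coef_sum coefXM coef_map /=.
    have := congr1 (fun p : T => (p`_e)@_(kappa j)) Ev.
    rewrite coef_sum raddf_sum coefXM /=.
    under eq_bigr => l _ do rewrite coefZ mul_mpolyC mcoeffZ.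
    under [X in _ -> X = _]eq_bigr => l _ do rewrite coefCM coef_map.
    by move=> ->; case: e => [|e]; rewrite ?mcoeff0.
  rewrite (bigD1 i) //= eqxx polyC1 !mul1r big1 ?addr0 // => l /negbTE.
  by rewrite eq_sym => ->; rewrite polyC0 mul0r.
have nzU : \det U0 != 0.
  apply/det0P => -[w nzw /rowP wU].
  have w1 : w 0 i1 = 0.
    have := wU i1; rewrite !mxE (bigD1 i1) //= big1 => [|i /negbTE ne].
      by rewrite !mxE eqxx addr0 => /eqP; rewrite mulf_eq0 (negbTE nzc) orbF => /eqP.
    by rewrite !mxE ne mulr0.
  case/rV0Pn: nzw => j; case/eqP; have := wU j.
  rewrite !mxE (bigD1 j) //= big1 => [|i /negbTE ne]; rewrite !mxE.
    by case: eqP => [->|_]; rewrite ?w1 // eqxx mulr1 addr0.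
  by case: eqP => [->|_]; rewrite ?w1 ?mul0r // ne mulr0.
have detE : (\det U0)%:P * \det (M G) = \det (M G') * 'X.
  have := congr1 determinant UM; rewrite !det_mulmx det_map_mx det_diag => ->.
  rewrite mulrC (bigD1 i1) //= mxE eqxx big1 ?mulr1 // => i /negbTE ne.
  by rewrite mxE ne.
have nzM' : \det (M G') != 0.
  apply: contra_eq_neq detE => ->; rewrite mul0r.
  by rewrite mulf_neq0 // polyC_eq0.
apply: (IHu G') => //; last by move=> i; rewrite /G'; case: eqP.
have := congr1 (fun p : {poly F} => size p) detE.
by rewrite size_Cmul // size_mulX // => E; rewrite -ltnS (leq_trans _ ltu) // E.
Qed.

End Limits.

Section Ideal.

Variables (R : comNzRingType) (n : nat) (g : 'I_n -> R).
Implicit Types p q : R.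

Definition in_ideal p := exists b : 'I_n -> R, p = \sum_i b i * g i.

Lemma in_ideal0 : in_ideal 0.
Proof. by exists (fun=> 0); rewrite big1 // => i _; rewrite mul0r. Qed.

Lemma in_ideal_gen i : in_ideal (g i).
Proof.
exists (fun j => (j == i)%:R); rewrite (bigD1 i) //= eqxx mul1r big1 ?addr0 //.
by move=> j /negbTE ->; rewrite mul0r.
Qed.

Lemma in_idealD p q : in_ideal p -> in_ideal q -> in_ideal (p + q).
Proof.
move=> [b ->] [c ->]; exists (fun i => b i + c i).
by rewrite -big_split; apply: eq_bigr => i _; rewrite mulrDl.
Qed.

Lemma in_idealMl p q : in_ideal q -> in_ideal (p * q).
Proof.
move=> [b ->]; exists (fun i => p * b i).
by rewrite mulr_sumr; apply: eq_bigr => i _; rewrite mulrA.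
Qed.

Lemma in_ideal_sum (I : Type) (r : seq I) (P : pred I) (p : I -> R) :
  (forall i, P i -> in_ideal (p i)) -> in_ideal (\sum_(i <- r | P i) p i).
Proof.
by move=> H; apply: big_ind => // [|p1 p2]; [exact: in_ideal0|exact: in_idealD].
Qed.

End Ideal.

(** * The deformed system *)

Section Deformation.

Variables (F : fieldType) (n : nat) (k : 'I_n -> nat) (f : 'I_n -> {mpoly F[n]}).
Notation A := {mpoly F[n]}.
Notation T := {poly A}.

(** For general [t] the equations [f_i + t^2 x_i^(k_i)] have, like the equations
    [x_i^(k_i)], no common zero at infinity. The parameter enters through its
    square so that an equation singular at a point remains singular, as an
    equation in [n + 1] variables. *)
Definition deform (i : 'I_n) : T := (f i)%:P + 'X^2 * ('X_i ^+ k i)%:P.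

(** The families of polynomials of degree at most [d] that belong to the ideal of
    the deformed system for [t != 0]. *)
Definition limit_family (d : nat) (v : T) :=
  (forall j, (msize v`_j <= d.+1)%N) /\ exists s, in_ideal deform ('X ^+ s * v).

Lemma msize_sum_le (I : finType) (p : I -> A) d :
  (forall i, (msize (p i) <= d)%N) -> (msize (\sum_i p i) <= d)%N.
Proof.
move=> H; apply: (leq_trans (msize_sum _ _ _)).
by apply/bigmax_leqP_seq => i _ _; apply: H.
Qed.

Lemma msizeM_pred (p q : A) :
  ((msize (p * q)).-1 <= (msize p).-1 + (msize q).-1)%N.
Proof.
have [->|nzp] := eqVneq p 0; first by rewrite mul0r msize0.
have [->|nzq] := eqVneq q 0; first by rewrite mulr0 msize0.
have : (0 < msize p)%N by rewrite lt0n msize_poly_eq0.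
have : (0 < msize q)%N by rewrite lt0n msize_poly_eq0.
by rewrite msizeM //; case: (msize p) => // x; case: (msize q) => // y; rewrite addnS.
Qed.

Lemma limit_family_lin d (I : finType) (c : I -> F) (v : I -> T) :
  (forall i, limit_family d (v i)) -> limit_family d (\sum_i (c i)%:MP *: v i).
Proof.
move=> H; split=> [j|].
  rewrite coef_sum; apply: msize_sum_le => i; rewrite coefZ mul_mpolyC.
  by apply: leq_trans (msizeZ_le _ _) _; case: (H i).
have [s Hs] := boolp.choice (fun i => (H i).2).
exists (\max_i s i)%N; rewrite mulr_sumr; apply: in_ideal_sum => i _.
rewrite -scalerAr -mul_polyC; apply: in_idealMl.
by rewrite -(subnK (leq_bigmax i)) exprD -mulrA; apply: in_idealMl.
Qed.

Lemma limit_family_divX d v : limit_family d ('X * v) -> limit_family d v.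
Proof.
case=> sz [s Hs]; split=> [j|]; first by have := sz j.+1; rewrite coefXM.
by exists s.+1; rewrite exprSr -mulrA.
Qed.

Lemma polyC_mul_deform (R : comNzRingType) (x y z : R) :
  x%:P * (z%:P + 'X^2 * y%:P) = 'X^2 * (x * y)%:P + (x * z)%:P.
Proof. by rewrite mulrDr addrC mulrCA -!polyCM. Qed.

Lemma coef_X2C (R : comNzRingType) (x y : R) (j : nat) :
  ('X^2 * x%:P + y%:P)`_j = (if j == 2 then x else 0) + (if j == 0 then y else 0).
Proof.
rewrite coefD coefXnM !coefC; congr (_ + _).
by case: j => [|[|[|j]]].
Qed.

(** The multiples [x^(m - k_i e_i) (f_i + t^2 x_i^(k_i))], for the monomials [x^m]
    divisible by some [x_i^(k_i)], are independent for general [t], since their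
    coefficients of these monomials form a matrix [t^2 + constant]. *)
Lemma exists_limit_families (d : nat) :
  (forall i, (msize (f i) <= (k i).+1)%N) ->
  exists (D : nat) (G : 'I_D -> T),
    [/\ (D + #|small_box k d.+1 d| = #|{: 'X_{1..n < d.+1}}|)%N,
        forall i, limit_family d (G i) &
        forall c : 'I_D -> F, \sum_i (c i)%:MP * (G i)`_0 = 0 -> forall i, c i = 0].
Proof.
move=> sz_f; pose in_box (m : 'X_{1..n < d.+1}) := [forall j, ((m : 'X_{1..n}) j < k j)%N].
pose E := [set m | ~~ in_box m].
have cardE : (#|E| + #|small_box k d.+1 d| = #|{: 'X_{1..n < d.+1}}|)%N.
  rewrite -[in RHS](cardC [pred m in E]); congr addn.
  have ltm (m : 'X_{1..n < d.+1}) j : ((m : 'X_{1..n}) j < d.+1)%N.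
    by rewrite (leq_ltn_trans _ (bmdeg m)) // mdegE (bigD1 j) //= leq_addr.
  pose h (m : 'X_{1..n < d.+1}) : {ffun 'I_n -> 'I_d.+1} := [ffun j => Ordinal (ltm m j)].
  have injh : injective h.
    move=> m1 m2 /ffunP eqh; apply: val_inj; apply/mnmP => i.
    by have := eqh i; rewrite !ffunE => /(congr1 val).
  rewrite -(card_imset _ injh); apply: eq_card => a.
  apply/idP/imsetP => [|[m mE ->]].
    rewrite inE => /andP []; rewrite inE => /forallP lta lea.
    have ma : (mdeg [multinom (a i : nat) | i < n] < d.+1)%N.
      by rewrite ltnS mdegE (leq_trans _ lea) //; apply: leq_sum => i _; rewrite mnmE.
    exists (BMultinom ma).
      by rewrite !inE negbK; apply/forallP => j; rewrite /= mnmE.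
    by apply/ffunP => i; rewrite ffunE; apply: val_inj => /=; rewrite mnmE.
  move: mE; rewrite !inE negbK => /forallP lt; apply/andP; split.
    by apply/forallP => j; rewrite ffunE /=; apply: lt.
  by rewrite -ltnS (leq_ltn_trans _ (bmdeg m)) // mdegE leq_sum // => j _; rewrite ffunE.
pose kappa (i : 'I_#|E|) : 'X_{1..n} := enum_val i.
have {}/boolp.choice [j0 Hj0] (i : 'I_#|E|) : exists j, (k j <= kappa i j)%N.
  have := enum_valP i; rewrite inE negb_forall => /existsP [j].
  by rewrite -leqNgt; exists j.
pose rest i := (kappa i - U_(j0 i) *+ k (j0 i))%MM.
have restE i : (rest i + U_(j0 i) *+ k (j0 i))%MM = kappa i.
  rewrite submK //; apply/mnm_lepP => j; rewrite mulmnE mnm1E.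
  by case: eqP => [<-|_]; rewrite ?mul1n ?mul0n.
pose G i := ('X_[rest i] : A)%:P * deform (j0 i).
have GE i : G i = 'X^2 * ('X_[kappa i] : A)%:P + ('X_[rest i] * f (j0 i))%:P.
  have <- : 'X_[rest i] * 'X_(j0 i) ^+ k (j0 i) = 'X_[kappa i] :> A.
    by rewrite mpolyXn -mpolyXD restE.
  exact: polyC_mul_deform.
have deg_kappa i : (mdeg (kappa i) < d.+1)%N by apply: bmdeg.
have sz_G i j : (msize (G i)`_j <= d.+1)%N.
  have sz1 : (msize ('X_[kappa i] : A) <= d.+1)%N by rewrite msizeX.
  have sz2 : (msize ('X_[rest i] * f (j0 i)) <= d.+1)%N.
    have := msizeM_pred 'X_[rest i] (f (j0 i)); have := sz_f (j0 i).
    have := deg_kappa i; rewrite -{1}restE mdegD mdegMn mdeg1 msizeX.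
    by lia.
  rewrite GE coef_X2C; apply: (leq_trans (msizeD_le _ _)); rewrite geq_max.
  by apply/andP; split; case: ifP => _; rewrite ?msize0.
have XG i : limit_family d (G i).
  split=> [j|]; first exact: sz_G.
  by exists 0%N; rewrite mul1r; apply/in_idealMl/in_ideal_gen.
exists #|E|.
have [|||G' XG' indG'] := @saturated_limits F n #|E| (limit_family d) _ _ kappa G XG.
- by move=> c v; apply: limit_family_lin.
- exact: limit_family_divX.
- pose C : 'M[F]_#|E| := \matrix_(i, j) ('X_[rest i] * f (j0 i))@_(kappa j).
  have -> : \matrix_(i, j) map_poly (mcoeff (kappa j)) (G i) =
      map_mx (comp_poly 'X^2) (char_poly_mx (- C)).
    apply/matrixP => i j; rewrite !mxE rmorphN opprK comp_polyD comp_polyC.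
    apply/polyP => l; rewrite coef_map GE coef_X2C /=.
    rewrite mcoeffD coefD coefC; congr (_ + _); last by case: eqP; rewrite ?mcoeff0.
    rewrite raddfMn /= comp_polyX coefMn coefXn.
    case: (l == 2); rewrite ?mcoeff0 ?mul0rn // mcoeffX.
    by rewrite (inj_eq val_inj) (inj_eq enum_val_inj).
  rewrite det_map_mx comp_poly_eq0 ?size_polyXn //.
  exact/monic_neq0/char_poly_monic.
by exists G'; split.
Qed.

End Deformation.

(** * Limits of the deformed ideal at an isolated zero *)

Section Germ.

Variables (F : fieldType) (n : nat) (a : {ffun 'I_n -> F}).
Notation A := {mpoly F[n]}.
Notation T := {poly A}.
Notation S := {mpoly F[n.+1]}.
Notation t := ('X_ord_max : S).

(** Translation of the point [a] to the origin. *)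
Definition recenter : A -> S :=
  comp_mpoly [tuple 'X_(lift ord_max j) + (a j)%:MP | j < n].

HB.instance Definition _ := GRing.RMorphism.on recenter.

(** The germ at [(a, 0)] of a polynomial in [x] and [t]. *)
Definition germ : T -> S := horner_eval t \o map_poly recenter.

HB.instance Definition _ :=
  GRing.RMorphism.copy germ (horner_eval t \o map_poly recenter).

Lemma mcoeff0_meval (m : nat) (p : {mpoly F[m]}) : p@_0%MM = p.@[fun=> 0].
Proof.
have [q Eq] := split_constant p.
rewrite [in RHS]Eq mevalD mevalC raddf_sum /= big1 ?addr0 // => j _.
by rewrite mevalM mevalXU mul0r.
Qed.

Lemma recenter_const p : (recenter p)@_0%MM = p.@[a].
Proof.
rewrite mcoeff0_meval comp_mpoly_meval; apply: meval_eq => j.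
by rewrite tnth_mktuple mevalD mevalXU mevalC add0r.
Qed.

Lemma recenterXB j : recenter ('X_j - (a j)%:MP) = 'X_(lift ord_max j).
Proof.
by rewrite /recenter comp_mpolyB comp_mpolyC comp_mpolyXU -tnth_nth tnth_mktuple addrK.
Qed.

Lemma germC p : germ p%:P = recenter p.
Proof. by rewrite /germ /= map_polyC /horner_eval hornerC. Qed.

Lemma germX : germ 'X = t.
Proof. by rewrite /germ /= map_polyX /horner_eval hornerX. Qed.

Lemma germ_split v : exists w, germ v = recenter v`_0 + t * germ w.
Proof.
have [|w Ew] := @poly_divX _ (v - (v`_0)%:P); first by rewrite coefB coefC subrr.
exists w; rewrite -germX -germC -rmorphM -Ew.
by rewrite -rmorphD addrC subrK.
Qed.

Lemma germ_const v : (germ v)@_0%MM = (v`_0).@[a].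
Proof.
have [w ->] := germ_split v; rewrite mcoeffD recenter_const.
by rewrite !mcoeff0_meval mevalM mevalXU mul0r addr0.
Qed.

End Germ.

Section IsolatedZero.

Variables (F : fieldType) (n : nat) (k : 'I_n -> nat) (f : 'I_n -> {mpoly F[n]}).
Variable a : {ffun 'I_n -> F}.
Notation A := {mpoly F[n]}.
Notation T := {poly A}.
Notation S := {mpoly F[n.+1]}.
Notation t := ('X_ord_max : S).

Hypothesis f_a : forall i, (f i).@[a] = 0.

(** In the local ring of [a], the ideal of the [f i] contains a power of the
    maximal ideal; [u] is the common denominator. *)
Hypothesis isolated : exists (u : A) (c : nat),
  u.@[a] != 0 /\ forall j, in_ideal f ((u * ('X_j - (a j)%:MP)) ^+ c).

Let g (i : 'I_n) : S := germ a (deform k f i).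

Lemma local_ideal_germ W v : in_ideal (deform k f) v -> local_ideal W g (germ a v).
Proof.
move=> [b ->]; rewrite rmorph_sum /=.
have -> : \sum_i germ a (b i * deform k f i) = \sum_i germ a (b i) * g i.
  by apply: eq_bigr => i _; rewrite rmorphM.
exact: local_ideal_gen.
Qed.

Lemma deform_lift (p : A) :
  in_ideal f p -> exists q, in_ideal (deform k f) (p%:P + 'X * q).
Proof.
move=> [b ->]; exists ('X * \sum_i (b i)%:P * ('X_i ^+ k i)%:P).
exists (fun i => (b i)%:P); rewrite mulrA -expr2 mulr_sumr rmorph_sum -big_split /=.
by apply: eq_bigr => i _; rewrite /deform mulrDr polyCM mulrCA.
Qed.

(** In the local ring of [(a, 0)], the denominator [u] is invertible. *)
Lemma germ_isolated : exists c, forall W (j : 'I_n),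
  exists q, local_ideal W g ('X_(lift ord_max j) ^+ c + t * q).
Proof.
have [u [c [nzu Hu]]] := isolated; exists c => W j.
have [q /(local_ideal_germ W)] := deform_lift (Hu j).
rewrite rmorphD rmorphM /= germC germX rmorphXn rmorphM /= recenterXB exprMn.
set y := 'X_(lift _ _) => Hq.
have [|w Hw] := @ord_ge_inverse _ _ W (recenter a u ^+ c).
  by rewrite -rmorphXn recenter_const rmorphXn expf_neq0.
exists (w * germ a q).
have -> : y ^+ c + t * (w * germ a q) =
    w * (recenter a u ^+ c * y ^+ c + t * germ a q) - y ^+ c * (recenter a u ^+ c * w - 1).
  by ring.
by apply: local_idealB; [apply: local_idealMl|apply/local_idealMl/local_ideal_ord].
Qed.

(** Otherwise a power of [t] would belong to the ideal of the germs of the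
    deformed equations, and the germ of their zero set would be empty outside
    [t = 0]. *)
Lemma limit_family_vanishes d v : 'I_n -> limit_family k f d v -> (v`_0).@[a] = 0.
Proof.
move=> i0 [_ [s Hs]]; apply/eqP; apply: contraT => nzv; exfalso.
have [c Hc] := germ_isolated.
apply: (@no_small_curve_germ _ _ g false i0 s c) => // [i|W p _].
  apply: ord_ge1; rewrite germ_const /deform coefD coefC coefXnM /= addr0; exact: f_a.
have [|w Hw] := @ord_ge_inverse _ _ W (germ a v); first by rewrite germ_const.
exists 0; have := local_ideal_germ W Hs; rewrite rmorphM rmorphXn /= germX => Hv.
have -> : t ^+ s * (p + t * 0) =
    (w * p) * (t ^+ s * germ a v) - (p * t ^+ s) * (germ a v * w - 1) by ring.
by apply: local_idealB; [apply: local_idealMl|apply/local_idealMl/local_ideal_ord].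
Qed.

(** If the limits generate the maximal ideal of the local ring of [a], then the
    germ of the deformed zero set is a transversal branch, and no equation in the
    pencil of the [f i] can be singular at [a]. *)
Lemma limit_family_nonsingular (lambda : 'I_n -> F) (i0 : 'I_n) :
  (forall j, exists d v (u : A), [/\ limit_family k f d v,
      v`_0 = u * ('X_j - (a j)%:MP) & u.@[a] != 0]) ->
  lambda i0 != 0 -> ~ ord_ge 2 (recenter a (\sum_i lambda i *: f i)).
Proof.
move=> smooth nzl ord2; have [c Hc] := germ_isolated.
have Hs j : exists s, forall W, exists q,
    local_ideal W g (t ^+ s * ('X_(lift ord_max j) + t * q)).
  have [d [v [u [[_ [s Hs]] Ev nzu]]]] := smooth j; exists s => W.
  have [w Ew] := germ_split a v.
  have := local_ideal_germ W Hs; rewrite rmorphM rmorphXn /= germX Ew Ev.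
  rewrite rmorphM /= recenterXB; set y := 'X_(lift _ _) => Hv.
  have [|u' Hu'] := @ord_ge_inverse _ _ W (recenter a u); first by rewrite recenter_const.
  exists (u' * germ a w).
  have -> : t ^+ s * (y + t * (u' * germ a w)) =
      u' * (t ^+ s * (recenter a u * y + t * germ a w)) -
      (t ^+ s * y) * (recenter a u * u' - 1) by ring.
  by apply: local_idealB; [apply: local_idealMl|apply/local_idealMl/local_ideal_ord].
have {Hs} [s Hs] : exists s, forall W j, exists q,
    local_ideal W g (t ^+ s * ('X_(lift ord_max j) + t * q)).
  have [s Es] := boolp.choice Hs; exists (\max_j s j)%N => W j.
  have [q Hq] := Es j W; exists q.
  by rewrite -(subnK (leq_bigmax j)) exprD -mulrA; apply: local_idealMl.
(* The singular equation of the pencil replaces the equation of index [i0]. *)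
pose h := \sum_i (lambda i)%:MP * g i.
pose g' i := if i == i0 then h else g i.
have gg' W p : local_ideal W g p -> local_ideal W g' p.
  move=> [b Hb]; pose e := b i0 * ((lambda i0)^-1)%:MP.
  exists (fun i => if i == i0 then e else b i - e * (lambda i)%:MP).
  suff -> : \sum_j (if j == i0 then e else b j - e * (lambda j)%:MP) * g' j =
      \sum_j b j * g j by [].
  rewrite (bigD1 i0) //= [RHS](bigD1 i0) //= /g' eqxx /h mulr_sumr (bigD1 i0) //=.
  rewrite -!addrA; congr (_ + _).
    by rewrite /e mulrA -[X in X * _]mulrA -mpolyCM mulVf // mpolyC1 mulr1.
  rewrite -big_split /=; apply: eq_bigr => j /negbTE ->.
  by rewrite mulrBl mulrA addrC subrK.
apply: (@no_small_curve_germ _ _ g' true i0 s c) => [i|W j|W p p0].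
- rewrite /g'; case: eqP => [_|_] /=; last first.
    apply: ord_ge1; rewrite germ_const /deform coefD coefC coefXnM /= addr0; exact: f_a.
  have -> : h = recenter a (\sum_i lambda i *: f i) +
      t ^+ 2 * \sum_i (lambda i)%:MP * recenter a ('X_i ^+ k i).
    rewrite /h rmorph_sum mulr_sumr -big_split /=; apply: eq_bigr => j _.
    rewrite -mul_mpolyC rmorphM /= [recenter a _%:MP]comp_mpolyC /g /deform.
    rewrite rmorphD rmorphM /= rmorphXn /= !germC germX mulrDr; congr (_ + _).
    exact: mulrCA.
  apply: ord_geD => //; rewrite mulrC; apply: ord_geMl.
  apply: (@ord_geX _ _ 1 _ 2); apply: ord_ge1.
  by rewrite mcoeffX mnm1_eq0.
- by have [q Hq] := Hc W j; exists q; apply: gg'.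
have [q Eq] := split_constant p; have {p0}p0 := p0 isT.
have [r Hr] := boolp.choice (Hs W).
exists (\sum_j q (lift ord_max j) * r j - q ord_max); apply: gg'.
have -> : t ^+ s * (p + t * (\sum_j q (lift ord_max j) * r j - q ord_max)) =
    \sum_j q (lift ord_max j) * (t ^+ s * ('X_(lift ord_max j) + t * r j)).
  rewrite Eq p0 mpolyC0 add0r big_ord_recr /=.
  have -> : \sum_(i < n) 'X_(widen_ord (leqnSn n) i) * q (widen_ord (leqnSn n) i) =
      \sum_(i < n) 'X_(lift ord_max i) * q (lift ord_max i).
    apply: eq_bigr => i _; suff -> : widen_ord (leqnSn n) i = lift ord_max i by [].
    by apply: val_inj; rewrite /= /bump leqNgt ltn_ord add0n.
  rewrite mulrBr addrACA subrr addr0 mulr_sumr -big_split mulr_sumr /=.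
  by apply: eq_bigr => j _; ring.
apply: (big_ind (local_ideal W g)) => [|p1 p2|j _].
- exact/local_ideal_ord/ord_ge0.
- exact: local_idealD.
- exact/local_idealMl/Hr.
Qed.

End IsolatedZero.

(** * Divided differences *)

Section Bidegree.

Variables (F : fieldType) (n : nat).
Notation A := {mpoly F[n]}.
Notation point := {ffun 'I_n -> F}.
Implicit Types (H : point -> A).

(** The polynomials in two sets of variables of total degree at most [d], seen as
    polynomials in the first set that depend on the point [a]. They are given as
    sums of products [p(x) q(a)], so that their degree in each set is visible. *)
Definition bideg (d : nat) H :=
  exists2 s : seq (A * A),
    all (fun r => (msize r.1).-1 + (msize r.2).-1 <= d)%N s &
    forall a, H a = \sum_(r <- s) r.2.@[a] *: r.1.

Lemma bideg0 d : bideg d (fun=> 0).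
Proof. by exists [::] => // a; rewrite big_nil. Qed.

Lemma bideg_left d (p : A) : ((msize p).-1 <= d)%N -> bideg d (fun=> p).
Proof.
move=> le; exists [:: (p, 1)] => [|a]; first by rewrite /= msize1 addn0 le.
by rewrite big_seq1 /= meval1 scale1r.
Qed.

Lemma bideg_right d (q : A) : ((msize q).-1 <= d)%N -> bideg d (fun a => (q.@[a])%:MP).
Proof.
move=> le; exists [:: (1, q)] => [|a]; first by rewrite /= msize1 le.
by rewrite big_seq1 /= -mul_mpolyC mulr1.
Qed.

Lemma bideg_eq d H H' : H =1 H' -> bideg d H -> bideg d H'.
Proof. by move=> eqH [s sz Hs]; exists s => // a; rewrite -eqH. Qed.

Lemma bidegD d H H' : bideg d H -> bideg d H' -> bideg d (fun a => H a + H' a).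
Proof.
move=> [s sz Hs] [s' sz' Hs']; exists (s ++ s') => [|a]; first by rewrite all_cat sz.
by rewrite big_cat Hs Hs'.
Qed.

Lemma bidegM d e H H' :
  bideg d H -> bideg e H' -> bideg (d + e) (fun a => H a * H' a).
Proof.
move=> [s sz Hs] [s' sz' Hs'].
exists [seq (r.1 * r'.1, r.2 * r'.2) | r <- s, r' <- s'] => [|a].
  apply/all_allpairsP => r r' rs rs' /=.
  have := allP sz r rs; have := allP sz' r' rs' => /= le1 le2.
  apply: leq_trans (leq_add (msizeM_pred _ _) (msizeM_pred _ _)) _.
  by rewrite addnACA leq_add.
rewrite Hs Hs' big_allpairs_dep mulr_suml; apply: eq_bigr => r _.
rewrite mulr_sumr; apply: eq_bigr => r' _ /=.
by rewrite mevalM -scalerAl -scalerAr scalerA.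
Qed.

Lemma bideg_sum d (I : Type) (r : seq I) (H : I -> point -> A) :
  (forall i, bideg d (H i)) -> bideg d (fun a => \sum_(i <- r) H i a).
Proof.
move=> HH; elim: r => [|i r IHr].
  by apply: bideg_eq (bideg0 d) => a; rewrite big_nil.
by apply: bideg_eq (bidegD (HH i) IHr) => a; rewrite big_cons.
Qed.

Lemma bideg_prod (I : Type) (r : seq I) (d : I -> nat) (H : I -> point -> A) :
  (forall i, bideg (d i) (H i)) ->
  bideg (\sum_(i <- r) d i)%N (fun a => \prod_(i <- r) H i a).
Proof.
move=> HH; elim: r => [|i r IHr].
  rewrite big_nil; apply: (@bideg_eq _ (fun=> 1)) => [a|]; first by rewrite big_nil.
  by apply: bideg_left; rewrite msize1.
rewrite big_cons; apply: bideg_eq (bidegM (HH i) IHr) => a; by rewrite big_cons.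
Qed.

(** On monomials, by
    [x_i x^m - a_i a^m = (x_i - a_i) x^m + a_i (x^m - a^m)]. *)
Lemma divided_difference (d : nat) (p : A) : (msize p <= d.+2)%N ->
  exists2 D : 'I_n -> point -> A, forall j, bideg d (D j) &
    forall a : point, p - (p.@[a])%:MP = \sum_j D j a * ('X_j - (a j)%:MP).
Proof.
have mono e : forall m : 'X_{1..n}, (mdeg m <= e.+1)%N ->
    exists2 D : 'I_n -> point -> A, forall j, bideg e (D j) &
    forall a : point, 'X_[m] - ((('X_[m] : A).@[a])%:MP) = \sum_j D j a * ('X_j - (a j)%:MP).
  have unit_case d' : exists2 D : 'I_n -> point -> A, forall j, bideg d' (D j) &
      forall a : point, 'X_[0] - ((('X_[0] : A).@[a])%:MP) = \sum_j D j a * ('X_j - (a j)%:MP).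
    exists (fun _ _ => 0) => [j|a]; first exact: bideg0.
    by rewrite mpolyX0 meval1 mpolyC1 subrr big1 // => j _; rewrite mul0r.
  elim: e => [|e IHe] m lem; have [->|nz] := eqVneq m 0%MM; try exact: unit_case.
  - have /mdeg1P [i /eqP ->] : mdeg m == 1%N.
      by rewrite eqn_leq lem lt0n mdeg_eq0.
    exists (fun j _ => (j == i)%:R) => [j|a].
      by apply: bideg_left; case: eqP; rewrite ?msize1 ?msize0.
    by rewrite mevalXU (bigD1 i) //= eqxx mul1r big1 ?addr0 // => j /negbTE ->; rewrite mul0r.
  - have [i nzi] : exists i, m i != 0%N.
      apply/existsP; apply: contraNT nz; rewrite negb_exists => /forallP z.
      by apply/eqP/mnmP => j; rewrite mnm0E; apply/eqP; have := z j; rewrite negbK.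
    have Em : (m - U_(i) + U_(i))%MM = m by rewrite submK // lep1mP.
    have lem' : (mdeg (m - U_(i))%MM <= e.+1)%N.
      by move: lem; rewrite -{1}Em mdegD mdeg1 addn1.
    have [D HD ED] := IHe _ lem'; set m' := (m - U_(i))%MM in Em lem' ED.
    exists (fun j (a : point) => (j == i)%:R * 'X_[m'] + (('X_i : A).@[a])%:MP * D j a) => [j|a].
      apply: bidegD.
        apply: bideg_left; case: eqP; rewrite ?mul0r ?msize0 // mul1r msizeX.
        by rewrite (leq_trans lem').
      rewrite -add1n; apply: bidegM => //; apply: bideg_right.
      by rewrite msizeX mdeg1.
    rewrite -Em mpolyXD mevalM mpolyCM mevalXU.
    under eq_bigr => j _ do rewrite mulrDl -[(a i)%:MP * _ * _]mulrA.
    rewrite big_split /= -mulr_sumr -ED (bigD1 i) //= eqxx mul1r big1 ?addr0.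
      by rewrite mulrBr mulrBr [(a i)%:MP * 'X_[m']]mulrC addrA subrK [X in _ - X]mulrC.
    by move=> j /negbTE ->; rewrite !mul0r.
move=> szp.
have {}mono (m : 'X_{1..n < d.+2}) := mono d m (bmdeg m).
pose PD (m : 'X_{1..n < d.+2}) (D : 'I_n -> point -> A) := (forall j, bideg d (D j)) /\
  forall a : point, 'X_[m] - ((('X_[m] : A).@[a])%:MP) = \sum_j D j a * ('X_j - (a j)%:MP).
have /boolp.choice [D HD] : forall m, exists D, PD m D.
  by move=> m; have [D HD ED] := mono m; exists D.
exists (fun j (a : point) => \sum_(m : 'X_{1..n < d.+2}) (p@_m)%:MP * D m j a) => [j|a].
  apply: bideg_sum => m; apply: (@bidegM 0 d); last by case: (HD m).
  by apply: bideg_left; rewrite msizeC; case: (_ != 0).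
under eq_bigr => j _ do rewrite mulr_suml.
have Ea : (p.@[a])%:MP_[n] =
    \sum_(m : 'X_{1..n < d.+2}) (p@_m)%:MP * (('X_[m] : A).@[a])%:MP.
  rewrite {1}(mpolywE szp) (raddf_sum (meval a)) /= (raddf_sum (@mpolyC n F)) /=.
  by apply: eq_bigr => m _; rewrite mevalZ mpolyCM.
rewrite exchange_big /= Ea {1}(mpolywE szp) -sumrB.
apply: eq_bigr => m _; rewrite -mul_mpolyC -mulrBr (HD m).2.
by rewrite mulr_sumr; apply: eq_bigr => j _; rewrite mulrA.
Qed.

End Bidegree.

(** * Hilbert's Nullstellensatz over an uncountable field *)

(** A set that is not a countable union of finite sets. *)
Definition uncountable_type (X : eqType) :=
  forall d : X -> nat, exists N, forall m, exists s : seq X,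
    [/\ uniq s, size s = m & all (fun x => d x <= N)%N s].

Section Nullstellensatz.

Variables (F : closedFieldType) (n : nat).
Hypothesis uncountableF : uncountable_type F.
Notation A := {mpoly F[n]}.

Let ideal (I : A -> Prop) :=
  [/\ I 0, forall p q, I p -> I q -> I (p + q) & forall p q, I q -> I (p * q)].

Let avoids (p : A) (I : A -> Prop) := forall c, ~ I (p ^+ c).

(** If for every [l] some power of [p] belonged to [I + (z - l)], say
    [p ^ c_l = q_l (z - l)] modulo [I], infinitely many of the [q_l] would have
    bounded degree. A linear relation between these becomes, after multiplication
    with the [z - l], a relation [p ^ N P(z) = 0] modulo [I] for a polynomial
    [P != 0] in one variable; as [P] splits, a power of [p] would belong to [I]. *)
Lemma exists_avoiding_value (p z : A) (I : A -> Prop) : ideal I -> avoids p I ->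
  exists l, avoids p (fun q => exists r, I (q - r * (z - l%:MP))).
Proof.
move=> [I0 ID IM] pI; apply: boolp.contrapT => no_value.
have IB u v : I u -> I v -> I (u - v).
  by move=> Iu Iv; rewrite -mulN1r; apply: ID => //; apply: IM.
have Isum (J : finType) (u : J -> A) : (forall j, I (u j)) -> I (\sum_j u j).
  by move=> Iu; apply: (big_ind I) => // ? ?; apply: ID.
have {no_value} all_l l : exists cq : nat * A, I (p ^+ cq.1 - cq.2 * (z - l%:MP)).
  apply: boolp.contrapT => nol; apply: no_value; exists l => c [r Hr].
  by apply: nol; exists (c, r).
have {all_l}/boolp.choice [cq Hcq] := all_l.
have [N HN] := uncountableF (fun l => (cq l).1 + (msize (cq l).2).-1)%N.
pose K := (\max_(j < N.+1) (msize (p ^+ j)).-1 + N)%N.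
have [s [us szs /allP leN]] := HN #|{: 'X_{1..n < K.+1}}|.+1.
set m := #|{: _}|.+1 in szs.
pose x (i : 'I_m) := nth 0 s i.
have xs i : x i \in s by rewrite mem_nth // szs.
have injx : injective x.
  by move=> i j /eqP; rewrite nth_uniq ?szs // => /eqP /val_inj.
pose q (i : 'I_m) := p ^+ (N - (cq (x i)).1) * (cq (x i)).2.
have Hq i : I (p ^+ N - q i * (z - (x i)%:MP)).
  have le : ((cq (x i)).1 <= N)%N by apply: leq_trans (leN _ (xs i)); apply: leq_addr.
  by rewrite -{1}(subnK le) exprD -mulrA -mulrBr; apply/IM/Hcq.
have szq i : (msize (q i) <= K.+1)%N.
  suff : ((msize (q i)).-1 <= K)%N by case: (msize _).
  apply: leq_trans (msizeM_pred _ _) _; apply: leq_add.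
    have ltN : (N - (cq (x i)).1 < N.+1)%N by rewrite ltnS leq_subr.
    exact: (leq_bigmax (Ordinal ltN)).
  by apply: leq_trans (leN _ (xs i)); apply: leq_addl.
have [|mu [i0 nz0] Hmu] :=
  @linear_dependence F 'I_m 'X_{1..n < K.+1} (fun i mo => (q i)@_mo).
  by rewrite card_ord.
have relq : \sum_i (mu i)%:MP * q i = 0.
  apply/mpolyP => mo; rewrite mcoeff0 raddf_sum /=.
  have [lt|le] := ltnP (mdeg mo) K.+1.
    rewrite -[RHS](Hmu (BMultinom lt)).
    by apply: eq_bigr => i _; rewrite mcoeffCM.
  rewrite big1 // => i _; rewrite mcoeffCM (memN_msupp_eq0 (msize_mdeg_ge _)) ?mulr0 //.
  exact: leq_trans (szq i) le.
pose hz : {poly F} -> A := horner_eval z \o map_poly (@mpolyC n F).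
pose P : {poly F} := \sum_i (mu i)%:P * \prod_(j | j != i) ('X - (x j)%:P).
have nzP : P != 0.
  apply: contraNneq nz0 => P0; have := congr1 (horner^~ (x i0)) P0.
  have off i : i != i0 -> (\prod_(j | j != i) ('X - (x j)%:P)).[x i0] = 0.
    by move=> ne; rewrite horner_prod (bigD1 i0) 1?eq_sym //= hornerXsubC subrr mul0r.
  rewrite horner0 /P horner_sum (bigD1 i0) //= [X in _ + X]big1 ?addr0 => [|i ne].
    rewrite hornerM hornerC horner_prod => /eqP; rewrite mulf_eq0 => /orP [//|].
    move/prodf_eq0 => [j ne]; rewrite hornerXsubC subr_eq0 (inj_eq injx) eq_sym.
    by rewrite (negbTE ne).
  by rewrite hornerM off // mulr0.
have hzX l : hz ('X - l%:P) = z - l%:MP.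
  by rewrite /hz /= /horner_eval rmorphB /= map_polyX map_polyC /= !hornerE.
have hzC l : hz l%:P = l%:MP.
  by rewrite /hz /= /horner_eval map_polyC /= !hornerE.
have hzM u v : hz (u * v) = hz u * hz v by rewrite /hz rmorphM.
have IP : I (p ^+ N * hz P).
  have -> : hz P = \sum_i (mu i)%:MP * \prod_(j | j != i) (z - (x j)%:MP).
    rewrite /hz /P rmorph_sum; apply: eq_bigr => i _.
    rewrite -[LHS]/(hz _) hzM hzC /hz rmorph_prod; congr (_ * _).
    by apply: eq_bigr => j _; apply: hzX.
  pose Z := \prod_j (z - (x j)%:MP).
  have -> : p ^+ N * \sum_i (mu i)%:MP * \prod_(j | j != i) (z - (x j)%:MP) =
      \sum_i ((mu i)%:MP * \prod_(j | j != i) (z - (x j)%:MP)) *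
        (p ^+ N - q i * (z - (x i)%:MP)) + (\sum_i (mu i)%:MP * q i) * Z.
    rewrite mulr_sumr mulr_suml -big_split /=; apply: eq_bigr => i _.
    rewrite /Z [in X in _ + X](bigD1 i) //=; move: (\prod_(_ | _) _) => Y; ring.
  rewrite relq mul0r addr0; apply: Isum => i; exact/IM/Hq.
have [r Er] := closed_field_poly_normal P.
have hzP : hz P = (lead_coef P)%:MP * \prod_(l <- r) (z - l%:MP).
  rewrite {1}Er -mul_polyC hzM hzC /hz rmorph_prod; congr (_ * _).
  by apply: eq_bigr => l _; apply: hzX.
have {}IP : I (p ^+ N * \prod_(l <- r) (z - l%:MP)).
  have := IM ((lead_coef P)^-1)%:MP _ IP; rewrite hzP mulrCA [_%:MP * (_ * _)]mulrA.
  by rewrite -mpolyCM mulVf ?lead_coef_eq0 // mpolyC1 mul1r.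
elim: r N IP {Er hzP HN K s us szs leN m x xs injx q Hq szq mu i0 nz0 Hmu relq P nzP} =>
  [|l r IHr] N IP.
  by apply: (pI N); rewrite big_nil mulr1 in IP.
apply: (IHr ((cq l).1 + N)%N).
rewrite big_cons in IP.
have -> : p ^+ ((cq l).1 + N) * \prod_(l <- r) (z - l%:MP) =
    (p ^+ N * \prod_(l <- r) (z - l%:MP)) * (p ^+ (cq l).1 - (cq l).2 * (z - l%:MP)) +
    (cq l).2 * (p ^+ N * ((z - l%:MP) * \prod_(l <- r) (z - l%:MP))).
  by rewrite exprD; ring.
by apply: ID; apply: IM => //; apply: Hcq.
Qed.

(** Fixing the values of the variables one after the other leads to a common zero
    of the [f i] outside the zero set of [p]. *)
Theorem nullstellensatz (f : 'I_n -> A) (p : A) :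
  (forall a : {ffun 'I_n -> F}, (forall i, (f i).@[a] = 0) -> p.@[a] = 0) ->
  exists c, in_ideal f (p ^+ c).
Proof.
move=> vanish; apply: boolp.contrapT => no_c.
have [I [idI fI pI XI]] : exists I : A -> Prop, [/\ ideal I, forall i, I (f i), avoids p I &
    forall j, j \in enum 'I_n -> exists l, I ('X_j - l%:MP)].
  elim: (enum 'I_n) => [|j s [I [idI fI pI XI]]].
    exists (in_ideal f); split=> // [|i|c Hc].
    - by split; [exact: in_ideal0|exact: in_idealD|exact: in_idealMl].
    - exact: in_ideal_gen.
    - by apply: no_c; exists c.
  have [l Hl] := exists_avoiding_value 'X_j idI pI; have [I0 ID IM] := idI.
  exists (fun q => exists r, I (q - r * ('X_j - l%:MP))); split=> //.
  - split=> [|u v [r Hr] [r' Hr']|u v [r Hr]].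
    + by exists 0; rewrite mul0r subr0.
    + exists (r + r'); rewrite mulrDl opprD addrACA; exact: ID.
    + by exists (u * r); rewrite -mulrA -mulrBr; apply: IM.
  - by move=> i; exists 0; rewrite mul0r subr0.
  - move=> i; rewrite inE => /orP [/eqP ->|/XI [l' Hl']].
      by exists l, 1; rewrite mul1r subrr.
    by exists l', 0; rewrite mul0r subr0.
have [I0 ID IM] := idI.
have {XI}/boolp.choice [l Hl] : forall j, exists l, I ('X_j - l%:MP).
  by move=> j; apply: XI; rewrite mem_enum.
pose a : {ffun 'I_n -> F} := [ffun j => l j].
have Ia q : I (q - (q.@[a])%:MP).
  have [|D _ ->] := @divided_difference F n (msize q) q; first by rewrite !leqW.
  by apply: (big_ind I) => // j _; apply: IM; rewrite ffunE; apply: Hl.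
have fa i : (f i).@[a] = 0.
  apply/eqP; apply: contraT => nz; case: (pI 0%N).
  rewrite expr0; have -> : 1 = (((f i).@[a])^-1)%:MP * (f i - (f i - ((f i).@[a])%:MP)).
    by rewrite subKr -mpolyCM mulVf // mpolyC1.
  by apply: (IM); apply: ID => //; rewrite -mulN1r; apply: (IM).
by case: (pI 1%N); rewrite expr1; have := Ia p; rewrite vanish // mpolyC0 subr0.
Qed.

End Nullstellensatz.

(** Cantor's nested intervals: if the sets [d <= N] were finite, one could choose
    decreasing closed intervals, the [N]-th of which misses the [N]-th set. *)
Lemma uncountable_real (R : realType) : uncountable_type R.
Proof.
move=> d; apply: boolp.contrapT => /boolp.forallNP fin.
have gap N (p : R * R) : exists q : R * R, p.1 < p.2 ->
    [/\ p.1 <= q.1, q.1 < q.2, q.2 <= p.2 &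
        forall x, q.1 <= x <= q.2 -> (N < d x)%N].
  have [ltp|] := boolP (p.1 < p.2); last by exists p.
  suff [q Hq] : exists q : R * R, [/\ p.1 <= q.1, q.1 < q.2, q.2 <= p.2 &
      forall x, q.1 <= x <= q.2 -> (N < d x)%N] by exists q.
  have /boolp.existsNP [m nos] := fin N.
  have {nos} : ~ exists s : seq R, [/\ uniq s, size s = m &
      all (fun x => (d x <= N)%N && (p.1 <= x <= p.2)) s].
    move=> [s [us szs als]]; apply: nos; exists s; split=> //.
    by apply: sub_all als => x /andP [].
  elim: m p ltp => [|m IHm] [a b] /= ltab nos; first by case: nos; exists [::].
  pose w := (b - a) / 3%:R.
  have Ew : b = a + w + w + w by rewrite /w; field.
  have w0 : 0 < w by rewrite divr_gt0 ?subr_gt0.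
  have [left|/boolp.existsNP [x /boolp.not_implyP [/andP [ax xa]]]] :=
    boolp.EM (forall x, a <= x <= a + w -> (N < d x)%N).
    by exists (a, a + w); split=> //=; lra.
  move=> /negP; rewrite -leqNgt => dx.
  have [|[s [us szs /allP als]]|[u v] /= [au uv vb H]] := IHm (a + w + w, b).
  - by rewrite /=; lra.
  - apply: nos; exists (x :: s); split=> /=; last 2 first.
    + by rewrite szs.
    + apply/andP; split; first by rewrite dx ax /=; lra.
      by apply/allP => y /als /= /andP [-> /andP [ya yb]]; apply/andP; split; lra.
    rewrite us andbT; apply/negP => /als /= /andP [_ /andP [ya yb]]; lra.
  - by exists (u, v); split=> //=; lra.
have [g Hg] := boolp.choice (fun Np => gap Np.1 Np.2).
pose ab := fix ab N := if N is M.+1 then g (M, ab M) else (0, 1) : R * R.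
have lt_ab N : (ab N).1 < (ab N).2.
  elim: N => [|N IHN] /=; first exact: ltr01.
  by case: (Hg (N, ab N)).
have step N := Hg (N, ab N) (lt_ab N).
have mono_a N M : (ab N).1 <= (ab (N + M)%N).1.
  elim: M => [|M IHM]; first by rewrite addn0.
  by rewrite addnS; apply: le_trans IHM _; case: (step (N + M)%N).
have mono_b N M : (ab (N + M)%N).2 <= (ab N).2.
  elim: M => [|M IHM]; first by rewrite addn0.
  by rewrite addnS; apply: le_trans _ IHM; case: (step (N + M)%N).
have le_ab N M : (ab N).1 <= (ab M).2.
  apply: le_trans (mono_a N M) _; apply: le_trans (ltW (lt_ab _)) _.
  by rewrite addnC.
pose E : classical_sets.set R := fun y => exists N, y = (ab N).1.
have supE : classical_sets.has_sup E.
  split; first by exists (ab 0%N).1, 0%N.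
  by exists (ab 0%N).2 => _ [N ->].
pose x := sup E.
have x_in N : (ab N).1 <= x <= (ab N).2.
  apply/andP; split; first by apply: sup_upper_bound => //; exists N.
  by apply: ge_sup; [case: supE|move=> _ [M ->]].
by have [_ _ _ /(_ x)] := step (d x); rewrite (x_in (d x).+1) ltnn => /(_ isT).
Qed.

Lemma uncountable_complex (R : realType) : uncountable_type (R[i] : eqType).
Proof.
move=> d; have [N HN] := uncountable_real (fun r : R => d r%:C%C).
exists N => m; have [s [us szs als]] := HN m.
exists [seq r%:C%C | r <- s]; split.
- by rewrite map_inj_uniq //; apply: complexI.
- by rewrite size_map.
- by rewrite all_map.
Qed.

(** * Complete intersections of the maximal number of points *)

Section CompleteIntersection.

Variables (F : closedFieldType) (n : nat) (k : 'I_n -> nat) (f : 'I_n -> {mpoly F[n]}).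
Hypothesis uncountableF : uncountable_type F.
Notation A := {mpoly F[n]}.
Notation point := {ffun 'I_n -> F}.
Variable Z : {fset point}.
Hypothesis zero_Z : forall x, x \in Z <-> common_zero f x.
Hypothesis msize_f : forall i, (msize (f i) <= (k i).+1)%N.
Hypothesis k_gt0 : forall i, (0 < k i)%N.
Variable i0 : 'I_n.

Lemma exists_separating (a : point) : exists u : A,
  u.@[a] = 1 /\ forall b, b \in Z -> b != a -> u.@[b] = 0.
Proof.
have sep b : exists u : A, u.@[a] = 1 /\ (b != a -> u.@[b] = 0).
  have [->|ne] := eqVneq b a; first by exists 1; rewrite meval1.
  have [j nej] : exists j, b j != a j.
    apply/existsP; apply: contraNT ne; rewrite negb_exists => /forallP eqab.
    by apply/eqP/ffunP => j; apply/eqP; have := eqab j; rewrite negbK.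
  have nz : a j - b j != 0 by rewrite subr_eq0 eq_sym.
  exists ((a j - b j)^-1 *: ('X_j - (b j)%:MP)).
  by rewrite !mevalZ !mevalB !mevalXU !mevalC subrr mulr0 mulVf.
have /boolp.choice [u Hu] := sep.
exists (\prod_(b : Z) u (val b)); split=> [|b bZ ne].
  by rewrite rmorph_prod big1 //= => b _; case: (Hu (val b)).
rewrite rmorph_prod (bigD1 [` bZ]%fset) //=.
by have [_ ->] := Hu b; rewrite ?mul0r.
Qed.

(** The Nullstellensatz applied to [u * (x_j - a_j)], where [u] vanishes at the
    other points of [Z]. *)
Lemma zero_isolated (a : point) : a \in Z -> exists (u : A) (c : nat),
  u.@[a] != 0 /\ forall j, in_ideal f ((u * ('X_j - (a j)%:MP)) ^+ c).
Proof.
move=> aZ; have [u [ua uZ]] := exists_separating a.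
have Hc j : exists c, in_ideal f ((u * ('X_j - (a j)%:MP)) ^+ c).
  apply: nullstellensatz => // b /zero_Z bZ; rewrite mevalM.
  have [->|ne] := eqVneq b a; first by rewrite mevalB mevalXU mevalC subrr mulr0.
  by rewrite uZ // mul0r.
have [c {}Hc] := boolp.choice Hc.
exists u, (\max_j c j)%N; split=> [|j]; first by rewrite ua oner_neq0.
by rewrite -(subnK (leq_bigmax j)) exprD; apply: in_idealMl.
Qed.

Lemma limit_family_vanishes_on d v (a : point) :
  a \in Z -> limit_family k f d v -> (v`_0).@[a] = 0.
Proof.
move=> aZ; apply: limit_family_vanishes i0; [exact/zero_Z|exact: zero_isolated].
Qed.

Lemma mpoly_eq0_bounded d (p : A) : (msize p <= d.+1)%N ->
  (forall m : 'X_{1..n < d.+1}, p@_m = 0) -> p = 0.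
Proof.
move=> szp p0; apply/mpolyP => m; rewrite mcoeff0.
have [lt|le] := ltnP (mdeg m) d.+1; first exact: (p0 (BMultinom lt)).
by apply: memN_msupp_eq0; apply: msize_mdeg_ge; apply: leq_trans le.
Qed.

(** Evaluation on [Z] kills the limits of the deformed ideal, and so separates the
    two parts of a linear relation. *)
Lemma limits_independent d D (G : 'I_D -> {poly A}) (I : finType) (g : I -> A) :
  (forall i, limit_family k f d (G i)) ->
  (forall c : 'I_D -> F, \sum_i (c i)%:MP * (G i)`_0 = 0 -> forall i, c i = 0) ->
  (forall i, (msize (g i) <= d.+1)%N) ->
  (forall c : I -> F, (forall a, a \in Z -> \sum_i c i * (g i).@[a] = 0) ->
     forall i, c i = 0) ->
  independent (fun (o : 'I_D + I) (m : 'X_{1..n < d.+1}) =>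
    (match o with inl i => (G i)`_0 | inr i => g i end)@_m).
Proof.
move=> XG indG szg indg c Hc.
pose h (o : 'I_D + I) : A := match o with inl i => (G i)`_0 | inr i => g i end.
have szh o : (msize (h o) <= d.+1)%N by case: o => i /=; [case: (XG i)|].
have E : \sum_o (c o)%:MP * h o = 0.
  apply: (@mpoly_eq0_bounded d) => [|m].
    apply: msize_sum_le => o; rewrite mul_mpolyC.
    exact: leq_trans (msizeZ_le _ _) (szh o).
  apply: etrans (Hc m); rewrite raddf_sum; apply: eq_bigr => o _ /=.
  by rewrite mcoeffCM.
rewrite big_sumType /= in E.
have c_r i : c (inr i) = 0.
  apply: (indg (fun i => c (inr i))) => a aZ.
  have := congr1 (meval a) E; rewrite mevalD meval0 !raddf_sum /= big1 ?add0r => [|j _].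
    by move=> E'; apply: etrans E'; apply: eq_bigr => j _; rewrite mevalM mevalC.
  by rewrite mevalM (limit_family_vanishes_on aZ (XG j)) mulr0.
rewrite [X in _ + X]big1 ?addr0 in E; last by move=> i _; rewrite c_r mpolyC0 mul0r.
by case=> i; [apply: (indG (fun i => c (inl i)))|apply: c_r].
Qed.

(** The upper bound for the Hilbert function: the limits of the deformed ideal
    vanish on [Z], and among the polynomials of degree at most [d] they form a
    space whose codimension is the value of the Hilbert function at [d]. *)
Lemma hilbert_function_bound d (I : finType) (g : I -> A) :
  (forall i, (msize (g i) <= d.+1)%N) ->
  (forall c : I -> F, (forall a, a \in Z -> \sum_i c i * (g i).@[a] = 0) ->
     forall i, c i = 0) ->
  (#|I| <= #|small_box k d.+1 d|)%N.
Proof.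
move=> szg indg; have [D [G [cardD XG indG]]] := exists_limit_families d msize_f.
have := independent_card (limits_independent XG indG szg indg).
by rewrite card_sum card_ord -cardD leq_add2l.
Qed.

Hypothesis card_Z : #|` Z| = (\prod_i k i)%N.

(** For large degrees, the limits of the deformed ideal have at most the
    codimension [#|Z|], which is that of the polynomials vanishing on [Z]. *)
Lemma vanishing_is_limit (h : A) : (forall a, a \in Z -> h.@[a] = 0) ->
  exists d v, limit_family k f d v /\ v`_0 = h.
Proof.
move=> hZ; have /boolp.choice [u Hu] := exists_separating.
pose d := (msize h + \sum_i k i + \max_(a : Z) msize (u (val a)))%N.
have [D [G [cardD XG indG]]] := exists_limit_families d msize_f.
have szu (a : Z) : (msize (u (val a)) <= d.+1)%N.
  by rewrite leqW // /d; apply: leq_trans (leq_addl _ _); apply: leq_bigmax.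
have uZ (a b : Z) : (u (val a)).@[val b] = (a == b)%:R.
  have [ua uN] := Hu (val a); have [->|ne] := eqVneq a b; first by case: (Hu (val b)).
  by apply: uN; [exact: valP|rewrite eq_sym].
have indu (c : Z -> F) : (forall a, a \in Z -> \sum_i c i * (u (val i)).@[a] = 0) ->
    forall i, c i = 0.
  move=> Hc i; rewrite -[RHS](Hc (val i) (valP i)) (bigD1 i) //= big1 ?addr0.
    by rewrite uZ eqxx mulr1.
  by move=> j /negbTE ne; rewrite uZ ne mulr0.
have ind := limits_independent XG indG szu indu.
have [|c Hc] := independent_span ind _ (fun m : 'X_{1..n < d.+1} => h@_m).
  rewrite card_sum card_ord -cardD leq_add2l -cardfE card_Z.
  rewrite -(@card_box _ d.+1 k) => [|i].
    by apply: subset_leq_card; apply/subsetP => a; rewrite inE => /andP [].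
  by rewrite leqW // /d (bigD1 i) //=; lia.
have Eh : h = \sum_i (c (inl i))%:MP * (G i)`_0 + \sum_a (c (inr a))%:MP * u (val a).
  apply/eqP; rewrite -subr_eq0; apply/eqP/(@mpoly_eq0_bounded d) => [|m].
    apply: leq_trans (msizeD_le _ _) _; rewrite msizeN geq_max.
    apply/andP; split; first by rewrite leqW // /d -addnA leq_addr.
    apply: leq_trans (msizeD_le _ _) _; rewrite geq_max.
    apply/andP; split; apply: msize_sum_le => i; rewrite mul_mpolyC;
      apply: leq_trans (msizeZ_le _ _) _ => //.
    by case: (XG i).
  rewrite mcoeffB Hc big_sumType /= mcoeffD !raddf_sum /=.
  by apply/eqP; rewrite subr_eq0; apply/eqP; congr (_ + _);
    apply: eq_bigr => i _; rewrite mcoeffCM.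
have c_r a : c (inr a) = 0.
  have := hZ _ (valP a); rewrite Eh mevalD !raddf_sum /= big1 ?add0r => [|i _]; last first.
    by rewrite mevalM (limit_family_vanishes_on (valP a) (XG i)) mulr0.
  rewrite (bigD1 a) //= big1 ?addr0; first by rewrite mevalM mevalC uZ eqxx mulr1.
  by move=> b /negbTE ne; rewrite mevalM uZ ne mulr0.
exists d, (\sum_i (c (inl i))%:MP *: G i); split; first exact: limit_family_lin.
rewrite Eh [X in _ = _ + X]big1 ?addr0; last by move=> a _; rewrite c_r mpolyC0 mul0r.
by rewrite coef_sum; apply: eq_bigr => i _; rewrite coefZ.
Qed.

Lemma zero_nonsingular (a : point) (lambda : 'I_n -> F) (j : 'I_n) :
  a \in Z -> lambda j != 0 -> ~ ord_ge 2 (recenter a (\sum_i lambda i *: f i)).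
Proof.
move=> aZ; apply: (@limit_family_nonsingular _ _ k) => [||i].
- exact/zero_Z.
- exact: zero_isolated.
have [u [ua uZ]] := exists_separating a.
have [|d [v [Xv Ev]]] := @vanishing_is_limit (u * ('X_i - (a i)%:MP)).
  move=> b bZ; rewrite mevalM; have [->|ne] := eqVneq b a.
    by rewrite mevalB mevalXU mevalC subrr mulr0.
  by rewrite uZ // mul0r.
by exists d, v, u; rewrite ua oner_neq0.
Qed.

(** The determinant of the divided differences of the [f i]. At [a = b] it is the
    Jacobian determinant; at two distinct points of [Z] it vanishes, because the
    matrix maps [b - a] to [f(b) - f(a) = 0]. A relation between the rows at [a = b]
    would be a singular combination of the [f i]. *)
Lemma exists_bezoutian : exists Delta : point -> A,
  [/\ bideg (\sum_i (k i).-1) Delta,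
      forall a b, a \in Z -> b \in Z -> a != b -> (Delta a).@[b] = 0 &
      forall a, a \in Z -> (Delta a).@[a] != 0].
Proof.
have HD i : exists D : 'I_n -> point -> A, (forall j, bideg (k i).-1 (D j)) /\
    forall a : point, f i - ((f i).@[a])%:MP = \sum_j D j a * ('X_j - (a j)%:MP).
  have [|D HD ED] := @divided_difference _ _ (k i).-1 (f i); last by exists D.
  by rewrite prednK.
have [D {}HD] := boolp.choice HD.
pose Q a : 'M[A]_n := \matrix_(i, j) D i j a.
have det_eval a b : (\det (Q a)).@[b] = \det (\matrix_(i, j) (D i j a).@[b]).
  by rewrite -det_map_mx; congr (\det _); apply/matrixP => i j; rewrite !mxE.
exists (fun a => \det (Q a)); split=> [|a b aZ bZ ne|a aZ].
- apply: (@bideg_eq _ _ _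
    (fun a : point => \sum_(s : 'S_n) (-1) ^+ s * \prod_i D i (s i) a)) => [a|].
    by apply: eq_bigr => s _; congr (_ * _); apply: eq_bigr => i _; rewrite mxE.
  apply: bideg_sum => s; apply: (@bidegM _ _ 0).
    by apply: bideg_left; case: (odd_perm s); rewrite ?expr1 ?msizeN msize1.
  by apply: (@bideg_prod _ _ _ _ _ (fun i => D i (s i))) => i; case: (HD i).
- rewrite det_eval -det_tr; apply/eqP/det0P.
  exists (\row_j (b j - a j)).
    apply: contraNneq ne => /rowP E; apply/eqP/ffunP => j; apply/eqP.
    by have := E j; rewrite !mxE => /eqP; rewrite subr_eq0 eq_sym.
  apply/rowP => i; rewrite !mxE.
  have := congr1 (meval b) ((HD i).2 a); rewrite mevalB mevalC.
  have /zero_Z -> := aZ; have /zero_Z -> := bZ; rewrite subr0 => E.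
  apply: etrans (esym E); rewrite raddf_sum; apply: eq_bigr => j _ /=.
  by rewrite !mxE mevalM mevalB mevalXU mevalC mulrC.
- rewrite det_eval; apply/det0P => -[w /rV0Pn [j nzj] wQ].
  apply: (zero_nonsingular (lambda := fun i => w 0 i) aZ nzj).
  have -> : \sum_i w 0 i *: f i =
      \sum_j (\sum_i w 0 i *: D i j a) * ('X_j - (a j)%:MP).
    under [RHS]eq_bigr => l _ do rewrite mulr_suml.
    rewrite exchange_big; apply: eq_bigr => i _ /=.
    under eq_bigr => l _ do rewrite -scalerAl.
    rewrite -scaler_sumr -(HD i).2; have /zero_Z -> := aZ; by rewrite mpolyC0 subr0.
  rewrite rmorph_sum; apply: ord_ge_sum => l; rewrite rmorphM /= recenterXB.
  apply: (@ord_geM _ _ 1 1); apply: ord_ge1; last by rewrite mcoeffX mnm1_eq0.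
  have /rowP /(_ l) := wQ; rewrite !mxE recenter_const raddf_sum /= => E; apply: etrans E.
  by apply: eq_bigr => i _; rewrite mevalZ mxE.
Qed.

(** If [At] is unisolvent for the degree [d], a polynomial of degree at most [d]
    that vanishes on [At] vanishes on [Z], by the bound for the Hilbert function.
    Suppose that weights [l] on the remaining points annihilate the polynomials of
    degree at most [m]. Summing [l b * Delta(a, b)] over [b] leaves of the
    Bezoutian only the terms of degree more than [m] in [b], which have degree at
    most [d] in [a]; but the sum is [l a * Delta(a, a)] for [a] in [Z], so it
    vanishes on [At], hence on [Z], and [l = 0]. *)
Lemma residual_interpolation (m d : nat) (At : {fset point}) :
  (m + d).+1 = (\sum_i (k i).-1)%N -> (At `<=` Z)%fset ->
  #|` At| = #|small_box k d.+1 d| ->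
  (forall q : point -> F, exists2 g : A, (msize g <= d.+1)%N &
     forall x, x \in At -> g.@[x] = q x) ->
  forall q : point -> F, exists2 g : A, (msize g <= m.+1)%N &
     forall x, x \in (Z `\` At)%fset -> g.@[x] = q x.
Proof.
move=> Emd /fsubsetP subAt cardAt interp q.
have vanish (g : A) : (msize g <= d.+1)%N -> (forall x, x \in At -> g.@[x] = 0) ->
    forall x, x \in Z -> g.@[x] = 0.
  move=> szg gAt x xZ; apply/eqP; apply: contraT => nzg.
  have /boolp.choice [u Hu] : forall p : At, exists u : A, (msize u <= d.+1)%N /\
      forall y, y \in At -> u.@[y] = (y == val p)%:R.
    by move=> p; have [u ? ?] := interp (fun y => (y == val p)%:R); exists u.
  pose h (o : option At) := if o is Some p then u p else g.
  have : (#|{: option At}| <= #|small_box k d.+1 d|)%N.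
    apply: (@hilbert_function_bound _ _ h) => [[p|] //|c Hc].
      by case: (Hu p).
    have c_Some p : c (Some p) = 0.
      have := Hc _ (subAt _ (valP p)); rewrite big_option gAt ?(valP p) // mulr0 add0r.
      rewrite (bigD1 p) //= big1 ?addr0 => [|p' ne].
        by rewrite (Hu p).2 ?(valP p) // eqxx mulr1.
      rewrite (Hu p').2 ?(valP p) // (inj_eq val_inj) eq_sym (negbTE ne).
      exact: mulr0.
    case=> [p|]; first exact: c_Some.
    have := Hc x xZ; rewrite big_option big1 ?addr0 => [|p _]; last by rewrite c_Some mul0r.
    by move/eqP; rewrite mulf_eq0 (negbTE nzg) orbF => /eqP.
  by rewrite card_option -cardfE cardAt ltnn.
set B := (Z `\` At)%fset.
have inB (b : B) : val b \notin At /\ val b \in Z.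
  by apply/andP; rewrite -in_fsetD; apply: valP.
have BZ b := (inB b).2.
have [span|[l [b0 nzl] Hl]] :=
  span_or_annihilate (fun (mo : 'X_{1..n < m.+1}) (b : B) => ('X_[mo] : A).@[val b]).
  have [c Hc] := span (fun b => q (val b)).
  exists (\sum_mo (c mo)%:MP * 'X_[mo]) => [|x xB].
    apply: msize_sum_le => mo; rewrite mul_mpolyC.
    by apply: leq_trans (msizeZ_le _ _) _; rewrite msizeX bmdeg.
  have <- := Hc [` xB]%fset; rewrite raddf_sum; apply: eq_bigr => mo _ /=.
  by rewrite mevalM mevalC.
exfalso; pose L (p : A) := \sum_b l b * p.@[val b].
have L0 p : (msize p <= m.+1)%N -> L p = 0.
  move=> szp; rewrite /L.
  under eq_bigr => b _ do rewrite {1}(mpolywE szp) raddf_sum mulr_sumr.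
  rewrite exchange_big big1 //= => mo _.
  transitivity (p@_mo * \sum_b l b * ('X_[mo] : A).@[val b]); last by rewrite Hl mulr0.
  by rewrite mulr_sumr; apply: eq_bigr => b _; rewrite mevalZ mulrCA.
have [Delta [[s sz_s Es] off diag]] := exists_bezoutian.
pose g := \sum_(r <- s | ((msize r.2).-1 <= d)%N) L r.1 *: r.2.
have szg : (msize g <= d.+1)%N.
  apply: leq_trans (msize_sum _ _ _) _; apply/bigmax_leqP_seq => r _ szr.
  by apply: leq_trans (msizeZ_le _ _) _; case: (msize r.2) szr.
have LDelta a : L (Delta a) = g.@[a].
  have -> : L (Delta a) = \sum_(r <- s) L r.1 * r.2.@[a].
    rewrite /L; under [RHS]eq_bigr => r _ do rewrite mulr_suml.
    rewrite exchange_big; apply: eq_bigr => b _ /=.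
    rewrite Es raddf_sum mulr_sumr; apply: eq_bigr => r _ /=.
    by rewrite mevalZ mulrCA mulrC.
  rewrite /g raddf_sum [LHS](bigID (fun r => ((msize r.2).-1 <= d)%N)) /=.
  rewrite [X in _ + X]big_seq_cond [X in _ + X]big1 ?addr0 => [|r /andP [rs]].
    by apply: eq_bigr => r _; rewrite mevalZ.
  rewrite -ltnNge => ltd; rewrite L0 ?mul0r //.
  by have := allP sz_s r rs; rewrite -Emd /=; case: (msize r.1) => //= x; lia.
have gZ : forall x, x \in Z -> g.@[x] = 0.
  apply: vanish => // x xAt; rewrite -LDelta /L big1 // => b _.
  rewrite off ?mulr0 ?BZ //; first exact: subAt.
  apply/eqP => xb.
  by have := (inB b).1; rewrite -xb xAt.
case/negP: nzl; have := gZ _ (BZ b0); rewrite -LDelta /L (bigD1 b0) //= big1 => [|b ne].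
  by rewrite addr0 => /eqP; rewrite mulf_eq0 (negbTE (diag _ (BZ b0))) orbF.
by rewrite off ?mulr0 ?BZ // eq_sym (inj_eq val_inj).
Qed.

End CompleteIntersection.

Local Open Scope fset_scope.

Theorem theorem5p4 (R : realType) (n m M : nat) (k : 'I_n -> nat)
    (hn : (0 < n)%N) (hk : forall i, (0 < k i)%N)
    (hM : M = (\sum_(i < n) k i - n)%N) (hm : (m < M)%N)
    (f : 'I_n -> {mpoly R[i][n]})
    (hdeg : forall i, has_degree (f i) (k i))
    (hsqf : forall i, no_multiple_factor (f i))
    (A At : {fset {ffun 'I_n -> R[i]}})
    (hA : forall x, x \in A <-> common_zero f x)
    (hN : #|` A| = (\prod_(i < n) k i)%N)
    (hAt : At `<=` A)
    (hppsn : ppsn k f (M - m - 1)%N At) :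
  ppsn k f m (A `\` At).
Proof.
set d := (M - m - 1)%N in hppsn; case: hppsn => _ cardAt interp.
have Emd : (m + d).+1 = (\sum_i (k i).-1)%N.
  have E : (\sum_i (k i).-1 + n = \sum_i k i)%N.
    rewrite -[X in (_ + X)%N]card_ord -sum1_card -big_split /=.
    by apply: eq_bigr => i _; rewrite addn1 prednK.
  by move: hm; rewrite /d hM -E addnK; lia.
have {}cardAt : #|` At| = #|small_box k d.+1 d|.
  by have := @e_along_card n k d.+1 d (ltnSn d); rewrite -cardAt => -[].
split=> [x|| ].
- by rewrite inE => /andP [_ /hA].
- pose K := (m + d + \sum_i k i).+1.
  have kK i : (0 < k i <= K)%N by rewrite hk /K (bigD1 i) //=; lia.
  have same : #|small_box k d.+1 d| = #|small_box k K d|.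
    have /eqP := @e_along_card n k d.+1 d (ltnSn d).
    by rewrite (@e_along_card n k K d) /K; [move=> /eqP [->]|lia].
  rewrite (@e_along_card n k K m); last by rewrite /K; lia.
  have := card_small_box_dual kK Emd; rewrite -hN cardfsD (fsetIidPr hAt) cardAt same.
  by move=> <-; rewrite addnK.
- apply: (residual_interpolation _ hA _ hk (Ordinal hn) hN Emd hAt cardAt interp).
    exact: uncountable_complex.
  by move=> i; rewrite hdeg.
Qed.
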